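(* Let $G$ be a connected graph with $|V(G)|\ge 8$. If $\Gamma_G<5.25$, then the master vertex $o$ of $G$ is contained in a $4$-clique $C$ such that there is a single edge $e=(o,u)$ between $C$ and $V(G)\setminus C$. In other words, $G$ is the disjoint union of $K_4$ and a connected graph $G'$ joined by a single additional edge $(o,u)$, where $o$ is a vertex of the $K_4$ and $u\in V(G')$. In particular, the closed neighborhood $N_G[o]$ (as an induced subgraph) is isomorphic to $K_4+P_1$. The same is true for connected graphs $G$ of order $7$ with the single exception $G=D+_sP_3$, for which $\Gamma_G\approx 5.180545$.
   Context: All graphs are finite and simple. For a connected graph $G$ with adjacency matrix $A_G$, let $x=(x_v)_{v\in V(G)}$ be the positive eigenvector (Perron vector, unique up to positive scaling) for the largest eigenvalue of $A_G$. The effective order is $\Gamma_G:=\big(\sum_v x_v\big)^2/\sum_v x_v^2$. A master vertex of $G$ is a vertex $o$ with $x_o\ge x_v$ for all $v\in V(G)$. $K_4+P_1$ is $K_4$ with one pendant leaf attached to one of its vertices. $D$ is the diamond graph ($K_4$ minus an edge) and $s$ is a vertex of degree $2$ in $D$; $D+_sP_3$ is the $7$-vertex graph obtained from the disjoint union of $D$ and the path $P_3$ on $3$ vertices by adding an edge joining $s$ to an endpoint of $P_3$. *)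

(* Defs.v *)
From mathcomp Require Import all_boot all_order all_algebra.
From mathcomp Require Import reals.

Set Implicit Arguments.
Unset Strict Implicit.
Unset Printing Implicit Defensive.
Import Order.TTheory GRing.Theory Num.Theory.
Local Open Scope ring_scope.

Record sgraph := SGraph {
  vertex :> finType;
  adj : rel vertex;
  adj_sym : symmetric adj;
  adj_irrefl : irreflexive adj }.

Definition graph_connected (G : sgraph) : Prop :=
  forall v w : G, connect (@adj G) v w.

Definition graph_iso (G H : sgraph) (f : G -> H) : Prop :=
  bijective f /\ forall v w : G, adj (f v) (f w) = adj v w.

Definition isomorphic (G H : sgraph) : Prop :=
  exists f : G -> H, graph_iso f.

Section Induced.
Variables (G : sgraph) (S : {set G}).

Definition induced_rel (v w : {v : G | v \in S}) : bool :=
  adj (val v) (val w).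

Lemma induced_sym : symmetric induced_rel.
Proof. by move=> v w; rewrite /induced_rel adj_sym. Qed.

Lemma induced_irrefl : irreflexive induced_rel.
Proof. by move=> v; rewrite /induced_rel adj_irrefl. Qed.

Definition induced : sgraph := SGraph induced_sym induced_irrefl.
End Induced.

Definition closed_nbhd (G : sgraph) (v : G) : {set G} :=
  [set w | (w == v) || adj v w].

Definition clique (G : sgraph) (C : {set G}) : Prop :=
  {in C &, forall v w, v != w -> adj v w}.

(* An edge between C and its complement appears exactly once, with its
   endpoint in C as first component. *)
Definition edge_cut (G : sgraph) (C : {set G}) : {set G * G} :=
  [set p | [&& p.1 \in C, p.2 \notin C & adj p.1 p.2]].

Section Complete.
Variable n : nat.

Definition complete_rel (i j : 'I_n) : bool := i != j.

Lemma complete_sym : symmetric complete_rel.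
Proof. by move=> i j; rewrite /complete_rel eq_sym. Qed.

Lemma complete_irrefl : irreflexive complete_rel.
Proof. by move=> i; rewrite /complete_rel eqxx. Qed.

Definition complete_graph : sgraph := SGraph complete_sym complete_irrefl.
End Complete.

Section Path.
Variable n : nat.

Definition path_rel (i j : 'I_n) : bool :=
  (i.+1 == j :> nat) || (j.+1 == i :> nat).

Lemma path_rel_sym : symmetric path_rel.
Proof. by move=> i j; rewrite /path_rel orbC. Qed.

Lemma path_rel_irrefl : irreflexive path_rel.
Proof. by move=> i; rewrite /path_rel orbb eqn_leq ltnn. Qed.

Definition path_graph : sgraph := SGraph path_rel_sym path_rel_irrefl.
End Path.

(* K_4 on {0, 1, 2, 3} minus the edge 01: the vertices 0 and 1 have degree 2. *)
Definition diamond_rel (i j : 'I_4) : bool :=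
  (i != j) && ~~ ((i < 2)%N && (j < 2)%N).

Lemma diamond_sym : symmetric diamond_rel.
Proof. by move=> i j; rewrite /diamond_rel eq_sym (andbC (i < 2)%N). Qed.

Lemma diamond_irrefl : irreflexive diamond_rel.
Proof. by move=> i; rewrite /diamond_rel eqxx. Qed.

Definition diamond : sgraph := SGraph diamond_sym diamond_irrefl.

(* Disjoint union of G and H with the additional edge between s in G and
   t in H. *)
Section EdgeJoin.
Variables (G : sgraph) (s : G) (H : sgraph) (t : H).

Definition edge_join_rel (v w : G + H) : bool :=
  match v, w with
  | inl a, inl b => adj a b
  | inr a, inr b => adj a b
  | inl a, inr b => (a == s) && (b == t)
  | inr a, inl b => (b == s) && (a == t)
  end.

Lemma edge_join_sym : symmetric edge_join_rel.
Proof. by case=> a [] b //=; rewrite adj_sym. Qed.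

Lemma edge_join_irrefl : irreflexive edge_join_rel.
Proof. by case=> a /=; rewrite adj_irrefl. Qed.

Definition edge_join : sgraph := SGraph edge_join_sym edge_join_irrefl.
End EdgeJoin.

Definition K4_plus_P1 : sgraph :=
  @edge_join (complete_graph 4) (@ord0 3) (path_graph 1) (@ord0 0).

Definition D_plus_P3 : sgraph :=
  @edge_join diamond (@ord0 3) (path_graph 3) (@ord0 2).

Definition adjacency_matrix (R : realType) (G : sgraph) : 'M[R]_#|G| :=
  \matrix_(i, j) (adj (enum_val i) (enum_val j))%:R.

Definition largest_eigenvalue (R : realType) (n : nat) (A : 'M[R]_n) (l : R) :
    Prop :=
  eigenvalue A l /\ forall m : R, eigenvalue A m -> m <= l.

(* eigenspace consists of row eigenvectors; adjacency matrices are symmetric,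
   so these are also the column eigenvectors. *)
Definition perron_vector (R : realType) (G : sgraph) (x : G -> R) : Prop :=
  (forall v, 0 < x v) /\
  exists2 l : R, largest_eigenvalue (adjacency_matrix R G) l &
    (\row_i x (enum_val i) <= eigenspace (adjacency_matrix R G) l)%MS.

(* Invariant under scaling of x, hence for a connected graph G it does not
   depend on the choice of the Perron vector x of G. *)
Definition effective_order (R : realType) (G : sgraph) (x : G -> R) : R :=
  (\sum_v x v) ^+ 2 / \sum_v x v ^+ 2.

Definition master_vertex (R : realType) (G : sgraph) (x : G -> R) (o : G) :
    Prop :=
  forall v, x v <= x o.

(* The connected graph G' to which K_4 is joined is taken to be the subgraph
   induced on the vertices outside C, with f restricting to its inclusion. *)
Definition pendant_K4_at (G : sgraph) (o : G) : Prop :=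
  exists (C : {set G}) (u : G),
    [/\ [/\ clique C, #|C| = 4%N, o \in C & edge_cut C = [set (o, u)]],
        graph_connected (induced (~: C)) /\
        (exists2 u' : induced (~: C), val u' = u &
          exists (o' : complete_graph 4)
                 (f : edge_join o' u' -> G),
            [/\ graph_iso f, f (inl o') = o & forall v, f (inr v) = val v])
      & isomorphic (induced (closed_nbhd o)) K4_plus_P1].

(* Main.v *)
Require Import Defs.
From Stdlib Require Import ZArith.
From mathcomp Require Import all_boot all_order all_algebra.
From mathcomp Require Import reals.
From mathcomp Require Import ssrZ zify ring lra.

Set Implicit Arguments.
Unset Strict Implicit.
Unset Printing Implicit Defensive.
Import Order.TTheory GRing.Theory Num.Theory.
Local Open Scope ring_scope.

(** Write $S=\sum_v x_v$ and $Q=\sum_v x_v^2$ for a Perron vector $x$ with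
    eigenvalue $\lambda$, so that $\Gamma<5.25$ means $4S^2<21Q$. Since
    $4(S-t)^2\ge 0$ for every real $t$, this fails as soon as
    $\sum_v x_v(8t-21x_v)\ge 4t^2$ for one $t$. If $8t\ge 21\max x$, all summands
    are nonnegative, so the sum may be restricted to any part of the graph
    about which something is known; and each summand is a concave function of
    $x_v$, so an interval containing $x_v$ bounds it from below by its value at
    an end. Hence a few vertices around the master vertex suffice to refute
    $\Gamma<5.25$, whatever the rest of the graph looks like.

    The necessary intervals come from $\lambda x_v=\sum_{w\sim v}x_w$: a weight is
    at least $1/\lambda$ times the sum over the known neighbours, and at most
    $1/\lambda$ times the sum over the possible neighbours once it is known that
    there are no others. An estimate by hand ([master_deg_lt6]) shows that the
    master vertex has at most five neighbours. For each of the degrees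
    $1,\dots,5$ the graph is explored by a case distinction ([branch]): halve the
    interval of $\lambda$ or of a weight, decide whether two known vertices are
    adjacent, or decide whether a known vertex has a further neighbour. The
    exploration terminates ([search_done]); each of its branches ends with
    contradictory intervals, with the inequality above, with the pendant
    $K_4$ of the theorem, or with all of $G$ known, and then $G$ has fewer than
    seven vertices or is $D+_sP_3$. [search_sound] says that the graph always
    follows one of the branches.

    For $D+_sP_3$ the eigenvalue equations are solved in terms of $\lambda$
    ([exceptional_system]). The eigenvalue is the only root above 2 of an
    explicit sextic, and enclosing it in an interval of length $10^{-9}$ gives
    the value of $\Gamma$. No vertex of $D+_sP_3$ has four neighbours, so there is
    no pendant $K_4$. *)

(** * Integers as real numbers *)

Section RealOfZ.
Variable R : realType.

(** The lock keeps conversion from unfolding the image of a numeral into a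
    unary sum. *)
Definition zr : Z -> R := locked (fun z => (int_of_Z z)%:~R).

Lemma zrE z : zr z = (int_of_Z z)%:~R.
Proof. by rewrite /zr -lock. Qed.

Lemma zrD a b : zr (Z.add a b) = zr a + zr b.
Proof. by rewrite !zrE -intrD -rmorphD. Qed.

Lemma zrN a : zr (Z.opp a) = - zr a.
Proof. by rewrite !zrE -intrN -rmorphN. Qed.

Lemma zrB a b : zr (Z.sub a b) = zr a - zr b.
Proof. by rewrite -zrN -zrD. Qed.

Lemma zrM a b : zr (Z.mul a b) = zr a * zr b.
Proof. by rewrite !zrE -intrM -rmorphM. Qed.

Lemma zr0 : zr Z0 = 0.
Proof. by rewrite zrE. Qed.

Lemma zr_nat n : zr (Z.of_nat n) = n%:R.
Proof. by rewrite !zrE pmulrn; congr (_%:~R); lia. Qed.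

Lemma zr_le a b : Z.le a b -> zr a <= zr b.
Proof. by move=> ab; rewrite !zrE ler_int; lia. Qed.

Lemma zr_lt a b : Z.lt a b -> zr a < zr b.
Proof. by move=> ab; rewrite !zrE ltr_int; lia. Qed.

Lemma zr_lt_inv a b : zr a < zr b -> Z.lt a b.
Proof. by rewrite !zrE ltr_int => ?; lia. Qed.

Lemma zr_ge0 a : Z.le Z0 a -> 0 <= zr a.
Proof. by move=> /zr_le; rewrite zr0. Qed.

Lemma zr_gt0 a : Z.lt Z0 a -> 0 < zr a.
Proof. by move=> /zr_lt; rewrite zr0. Qed.

Lemma zr_max a b x : zr a <= x -> zr b <= x -> zr (Z.max a b) <= x.
Proof. by case: (Z.max_spec a b) => -[_ ->]. Qed.

Lemma zr_min a b x : x <= zr a -> x <= zr b -> x <= zr (Z.min a b).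
Proof. by case: (Z.min_spec a b) => -[_ ->]. Qed.

Lemma zr_div_lo a b x : 0 < zr b -> zr a <= zr b * x -> zr (Z.div a b) <= x.
Proof.
move=> b0 ab; have /zr_lt_inv b0' : zr Z0 < zr b by rewrite zr0.
rewrite -(ler_pM2l b0) (le_trans _ ab)// -zrM; apply: zr_le.
by apply: Z.mul_div_le; lia.
Qed.

Lemma zr_div_hi a b x : 0 < zr b -> zr b * x <= zr a ->
  x <= zr (Z.opp (Z.div (Z.opp a) b)).
Proof.
move=> b0 ab; rewrite zrN lerNr; apply: zr_div_lo => //.
by rewrite zrN mulrN lerN2.
Qed.

End RealOfZ.

(** * The search *)

Section Search.
Local Open Scope Z_scope.

(** The master vertex has weight 1024, and [lam_lo] and [lam_hi] enclose
    $1024\lambda$. With a power of two, multiplication by the scale is a shift. *)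
Definition scale : Z := 1024.

(** What is known of $G$ on some vertices $p_0,\dots,p_{k-1}$. A pair is [None]
    while its adjacency is undecided, and $p_i$ is saturated if it is known to
    have no neighbour outside $p$. *)
Record pattern := Pattern {
  lo : seq Z;
  hi : seq Z;
  pairs : seq (seq (option bool));
  saturated : seq bool;
  lam_lo : Z;
  lam_hi : Z }.

Definition pair_row (s : pattern) (i : nat) : seq (option bool) :=
  nth [::] (pairs s) i.

Fixpoint sure_sum (r : seq (option bool)) (x : seq Z) : Z :=
  if x is a :: x' then
    let t := sure_sum (behead r) x' in
    if head None r is Some true then a + t else t
  else 0.

Fixpoint possible_sum (r : seq (option bool)) (x : seq Z) : Z :=
  if x is a :: x' then
    let t := possible_sum (behead r) x' in
    if head None r is Some false then t else a + t
  else 0.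

Definition zsum (f : nat -> Z) (k : nat) : Z :=
  foldr (fun i t => f i + t) 0 (iota 0 k).

(** Besides the eigenvalue equation these bounds use that positions
    $1,\dots,d$ are occupied by the neighbours of the master vertex in
    decreasing order of weight. *)
Definition tighter_lo (d : nat) (s : pattern) (v : nat) : Z :=
  let a := Z.max (nth 0 (lo s) v)
             (scale * sure_sum (pair_row s v) (lo s) / lam_hi s) in
  if (0 < v < d)%N then Z.max a (nth 0 (lo s) v.+1) else a.

Definition tighter_hi (d : nat) (s : pattern) (v : nat) : Z :=
  let h := nth 0 (hi s) v in
  let a :=
    if nth false (saturated s) v then
      if 0 <? lam_lo s then
        Z.min h (- (- (scale * possible_sum (pair_row s v) (hi s)) / lam_lo s))
      else h
    else h in
  if (1 < v <= d)%N then Z.min a (nth 0 (hi s) v.-1) else a.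

Definition tighten (d : nat) (s : pattern) : pattern :=
  Pattern (mkseq (tighter_lo d s) (size (lo s)))
          (mkseq (tighter_hi d s) (size (lo s)))
          (pairs s) (saturated s) (lam_lo s) (lam_hi s).

Definition infeasible (s : pattern) : bool :=
  has (fun i => nth 0 (hi s) i <? nth 0 (lo s) i) (iota 0 (size (lo s))).

(** What the eigenvalue equation at $p_v$ leaves to neighbours outside $p$. *)
Definition forced_outside (s : pattern) (v : nat) : Z :=
  if nth false (saturated s) v then 0
  else lam_lo s * Z.max 0 (nth 0 (lo s) v) / scale
       - possible_sum (pair_row s v) (hi s).

(** In a connected graph with at least seven vertices a smaller pattern has
    an outside neighbour of some unsaturated $p_v$, and that neighbour weighs at
    least $1/\lambda$ times as much as $p_v$. *)
Definition next_outside (s : pattern) : Z :=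
  if (size (lo s) < 7)%N then
    scale * foldr (fun v t => if nth false (saturated s) v then t
                              else Z.min (nth 0 (lo s) v) t)
              scale (iota 0 (size (lo s))) / lam_hi s
  else 0.

Definition outside (s : pattern) : Z :=
  Z.min scale
    (foldr (fun v t => Z.max (forced_outside s v) t) (Z.max 0 (next_outside s))
       (iota 0 (size (lo s)))).

(** The best $t$ is $S$; this is a lower estimate of it. *)
Definition tangency (d : nat) (s : pattern) : Z :=
  Z.max (zsum (nth 0 (lo s)) (size (lo s)))
    (scale + lam_lo s +
     zsum (fun i => if (i <= d)%N then 0 else nth 0 (lo s) i) (size (lo s)))
  + outside s.

Definition worst_is_hi (d : nat) (s : pattern) (t mu : Z) (i : nat) : bool :=
  8 * t - (if (0 < i <= d)%N then mu else 0)
    <? 21 * (nth 0 (lo s) i + nth 0 (hi s) i).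

(** Lower bound for $\sum_i x_i(8t-21x_i)-4t^2$ over the pattern, each summand
    being minimal at an end of its interval. The weights at positions
    $1,\dots,d$ sum to the eigenvalue, so a multiple $\mu=4096m$ of their
    difference may be added; without it the ends would be chosen
    independently and much would be lost. [lo2] and [hi2] hold the squares of
    the ends, which do not depend on $m$. *)
Definition margin (d : nat) (s : pattern) (t : Z) (lo2 hi2 : seq Z) (m : Z) : Z :=
  let k := size (lo s) in
  let w := mkseq (worst_is_hi d s t (4 * (scale * m))) k in
  let e i := if nth false w i then nth 0 (hi s) i else nth 0 (lo s) i in
  4 * (t * (2 * zsum e k - t))
  + 4 * (scale * (m * (lam_lo s -
      zsum (fun i => if (0 < i <= d)%N then e i else 0) k)))
  - 21 * zsum (fun i => if nth false w i then nth 0 hi2 i else nth 0 lo2 i) k.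

Definition spread (d : nat) (s : pattern) : bool :=
  let t := tangency d s in
  let g := outside s in
  if 21 * scale <=? 8 * t then
    let lo2 := [seq a * a | a <- lo s] in
    let hi2 := [seq a * a | a <- hi s] in
    let out := Z.min (g * (8 * t - 21 * g)) (scale * (8 * t - 21 * scale)) in
    has (fun m => 0 <=? margin d s t lo2 hi2 m + out) [:: 2; 4; 0; 3; 1]
  else false.

Definition pendant (d : nat) (s : pattern) : bool :=
  if d == 4%N then
    has (fun u => let T := rem u [:: 1; 2; 3; 4]%N in
      all (fun v => if nth false (saturated s) v then
         all (fun w => nth None (pair_row s v) w
                       == Some ((w != v) && (w \in 0%N :: T)))
           (iota 0 (size (lo s))) else false) T) [:: 1; 2; 3; 4]%N
  else false.

(** The adjacency matrix of $D+_sP_3$, in the order of [exceptional_list]. *)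
Definition exceptional_pairs : seq (seq (option bool)) :=
  let y := Some true in let n := Some false in
  [:: [:: n; y; y; y; n; n; n];
      [:: y; n; y; y; n; n; n];
      [:: y; y; n; n; y; n; n];
      [:: y; y; n; n; n; n; n];
      [:: n; n; y; n; n; y; n];
      [:: n; n; n; n; y; n; y];
      [:: n; n; n; n; n; y; n]].

(** By connectedness a pattern with all vertices saturated is all of $G$. *)
Definition terminal (s : pattern) : bool :=
  if all id (saturated s) then
    if (size (lo s) < 7)%N then true
    else if (size (lo s) == 7)%N then pairs s == exceptional_pairs else false
  else false.

Definition split_lam (s : pattern) : seq pattern :=
  let m := (lam_lo s + lam_hi s) / 2 in
  [:: Pattern (lo s) (hi s) (pairs s) (saturated s) (lam_lo s) m;
      Pattern (lo s) (hi s) (pairs s) (saturated s) m (lam_hi s)].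

Definition split_weight (i : nat) (s : pattern) : seq pattern :=
  let m := (nth 0 (lo s) i + nth 0 (hi s) i) / 2 in
  [:: Pattern (lo s) (set_nth 0 (hi s) i m) (pairs s) (saturated s)
        (lam_lo s) (lam_hi s);
      Pattern (set_nth 0 (lo s) i m) (hi s) (pairs s) (saturated s)
        (lam_lo s) (lam_hi s)].

Definition set_pair (P : seq (seq (option bool))) (i j : nat) (b : bool) :=
  set_nth [::] P i (set_nth None (nth [::] P i) j (Some b)).

Definition split_pair (i j : nat) (s : pattern) : seq pattern :=
  [seq Pattern (lo s) (hi s) (set_pair (set_pair (pairs s) i j b) j i b)
     (saturated s) (lam_lo s) (lam_hi s) | b <- [:: true; false]].

(** The new vertex is not adjacent to the saturated ones. *)
Definition split_nbhd (v : nat) (s : pattern) : seq pattern :=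
  let new := mkseq (fun i => if nth false (saturated s) i then Some false
                             else if i == v then Some true else None)
               (size (lo s)) in
  [:: Pattern (lo s) (hi s) (pairs s) (set_nth false (saturated s) v true)
        (lam_lo s) (lam_hi s);
      Pattern (rcons (lo s) 0) (rcons (hi s) scale)
        (rcons [seq rcons p.1 p.2 | p <- zip (pairs s) new]
           (rcons new (Some false)))
        (rcons (saturated s) false) (lam_lo s) (lam_hi s)].

Definition width (s : pattern) (i : nat) : Z := nth 0 (hi s) i - nth 0 (lo s) i.

Definition widest (s : pattern) : nat :=
  foldr (fun i best => if width s best <? width s i then i else best) 0%N
    (iota 0 (size (lo s))).

Definition undecided (b : option bool) : bool :=
  if b is None then true else false.

(** The order of the cases, the two thresholds and the bound 9 on the size
    affect only the number of patterns visited. *)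
Definition branch (s : pattern) : seq pattern :=
  let k := size (lo s) in
  let i := find (has undecided) (pairs s) in
  let j := find undecided (pair_row s i) in
  let v := find negb (saturated s) in
  let m := widest s in
  if scale <? 4 * (lam_hi s - lam_lo s) then split_lam s
  else if (i < j < k)%N then split_pair i j s
  else if (if scale <? 2 * width s m then (m < k)%N else false)
    then split_weight m s
  else if (v < k < 9)%N then split_nbhd v s
  else if width s m <? lam_hi s - lam_lo s then split_lam s
  else if (m < k)%N then split_weight m s else [:: s].

(** The nested conditionals, unlike boolean disjunction, are not evaluated
    eagerly. *)
Fixpoint search (d fuel : nat) (s : pattern) : bool :=
  if fuel is fuel'.+1 then
    let t := tighten d s in
    if infeasible t then true else
    if spread d t then true else
    if pendant d t then true else
    if terminal t then true else
    all (search d fuel') (branch t)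
  else false.

(** A master vertex of degree $d$ with its neighbours; here $1\le\lambda\le d$ and
    $\lambda<17/4$. *)
Definition start (d : nat) : pattern :=
  Pattern (scale :: nseq d 0) (nseq d.+1 scale)
    ((Some false :: nseq d (Some true)) ::
     mkseq (fun j => Some true :: set_nth None (nseq d None) j (Some false)) d)
    (true :: nseq d false) scale
    (Z.min (Z.of_nat d * scale) (17 * scale / 4)).

End Search.

Lemma search_done : all (fun d => search d 70 (start d)) [:: 1; 2; 3; 4; 5].
Proof. by vm_cast_no_check (erefl true). Qed.

Lemma zr_sum (R : realType) f k :
  zr R (zsum f k) = \sum_(0 <= i < k) zr R (f i).
Proof.
rewrite /zsum /index_iota subn0.
elim: (iota 0 k) => [|i t IH] /=; first by rewrite zr0 big_nil.
by rewrite big_cons zrD IH.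
Qed.

(** * Graphs *)

Lemma connected_ind (G : sgraph) (A : G -> Prop) (o : G) :
  graph_connected G -> A o ->
  (forall v w, A v -> adj v w -> A w) -> forall w, A w.
Proof.
move=> conn oA cl w; have /connectP[q] := conn o w.
elim: q o oA => [|v q IH] o oA /=; first by move=> _ ->.
by case/andP=> ov; apply: IH; exact: cl ov.
Qed.

Lemma isomorphic_of_lists (G H : sgraph) (p : seq G) (q : seq H) (p0 : G) (q0 : H) :
  uniq p -> uniq q -> size p = size q ->
  (forall v, v \in p) -> (forall w, w \in q) ->
  (forall i j, (i < size p)%N -> (j < size p)%N ->
     adj (nth p0 p i) (nth p0 p j) = adj (nth q0 q i) (nth q0 q j)) ->
  isomorphic G H.
Proof.
move=> up uq spq allp allq adjE.
have ip v : (index v p < size p)%N by rewrite index_mem.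
exists (fun v => nth q0 q (index v p)); split.
  exists (fun w => nth p0 p (index w q)) => v.
    by rewrite index_uniq -?spq// nth_index.
  by rewrite index_uniq ?spq ?index_mem// nth_index.
by move=> v w; rewrite -adjE// !nth_index.
Qed.

Section PendantK4.
Variables (G : sgraph) (o u a b c : G).
Hypothesis conn : graph_connected G.
Hypothesis dist : uniq [:: o; u; a; b; c].
Hypothesis adj_o : forall w, adj o w = (w \in [:: u; a; b; c]).
Hypothesis adj_a : forall w, adj a w = (w \in [:: o; b; c]).
Hypothesis adj_b : forall w, adj b w = (w \in [:: o; a; c]).
Hypothesis adj_c : forall w, adj c w = (w \in [:: o; a; b]).

Let C : {set G} := [set w in [:: o; a; b; c]].

Let neqE : ((o == u = false) * (o == a = false) * (o == b = false) * (o == c = false) *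
  (u == a = false) * (u == b = false) * (u == c = false) * (a == b = false) *
  (a == c = false) * (b == c = false) * (u == o = false) * (a == o = false) *
  (b == o = false) * (c == o = false) * (a == u = false) * (b == u = false) *
  (c == u = false) * (b == a = false) * (c == a = false) * (c == b = false))%type.
Proof.
move: dist; rewrite /= !inE !negb_or => /and5P[/and4P[? ? ? ?] /and3P[? ? ?] /andP[? ?] ? _].
by do ![split]; apply/negbTE => //; rewrite eq_sym.
Qed.

Let mem_C v : (v \in C) = [|| v == o, v == a, v == b | v == c].
Proof. by rewrite !inE. Qed.

Let u_notin_C : u \notin C.
Proof. by rewrite mem_C !neqE. Qed.

Lemma pendant_cut v w : v \in C -> w \notin C ->
  adj v w = (v == o) && (w == u).
Proof.
rewrite !mem_C !negb_or => vC /and4P[wo wa wb wc].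
by case/or4P: vC => /eqP->; rewrite ?adj_o ?adj_a ?adj_b ?adj_c !inE ?eqxx ?neqE
  ?(negPf wo) ?(negPf wa) ?(negPf wb) ?(negPf wc) ?orbF.
Qed.

Lemma pendant_clique : clique C.
Proof.
move=> v w; rewrite !mem_C.
by move=> /or4P[]/eqP-> /or4P[]/eqP->; rewrite ?eqxx ?adj_o ?adj_a ?adj_b ?adj_c !inE ?eqxx ?neqE ?orbT.
Qed.

Lemma card_pendant_clique : #|C| = 4%N.
Proof.
by rewrite cardsE (card_uniqP _)//= !inE !neqE.
Qed.

Let u' : induced (~: C) := exist (fun v => v \in ~: C) u
  (etrans (in_setC _ _) u_notin_C).

(** Only the edge from [o] to [u] leaves [C]. Hence [C] together with what is
    reachable from [u] outside [C] is closed under adjacency, and is all of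
    [G]. *)
Lemma rest_connected : graph_connected (induced (~: C)).
Proof.
have csym : connect_sym (@adj (induced (~: C))) by apply: sym_connect_sym; exact: adj_sym.
have fromu v : v \notin C ->
    exists2 v' : induced (~: C), val v' = v & connect (@adj _) u' v'.
  move: v; apply: (@connected_ind G _ o conn); first by rewrite mem_C eqxx.
  move=> v w vB vw wC; have wC' : w \in ~: C by rewrite inE.
  exists (exist _ w wC') => //.
  case: (boolP (v \in C)) => [vC|/vB[v' v'v uv']].
    move: vw; rewrite pendant_cut// => /andP[_ /eqP wu].
    by rewrite (_ : exist _ w wC' = u') ?connect0//; exact: val_inj.
  apply: connect_trans uv' (connect1 _).
  by rewrite /= /induced_rel v'v.
have {}fromu v' : connect (@adj (induced (~: C))) u' v'.
  have [|w wv] := fromu (val v'); first by have := valP v'; rewrite inE.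
  by rewrite (val_inj wv).
by move=> v w; apply: (@connect_trans _ _ u'); rewrite // csym.
Qed.

Lemma nbhd_iso : isomorphic (induced (closed_nbhd o)) K4_plus_P1.
Proof.
have N v : v \in [:: o; u; a; b; c] -> v \in closed_nbhd o.
  by rewrite !inE adj_o !inE.
pose p : seq (induced (closed_nbhd o)) := pmap insub [:: o; u; a; b; c].
have pE : map val p = [:: o; u; a; b; c].
  rewrite /p pmap_filter; last exact: insubK.
  by apply/all_filterP/allP => v /N vN; rewrite /= insubT.
have sp : size p = 5%N by rewrite -(size_map val) pE.
pose k i (i4 : (i < 4)%N) : K4_plus_P1 := inl (Ordinal i4).
apply: (@isomorphic_of_lists _ _ p
  [:: k 0 isT; inr ord0; k 1 isT; k 2 isT; k 3 isT]
  (exist _ o (N o (mem_head _ _))) (inr ord0)).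
- by rewrite -(map_inj_uniq val_inj) pE.
- by [].
- by rewrite sp.
- move=> v; rewrite -(mem_map val_inj) pE.
  by have := valP v; rewrite !inE adj_o !inE.
- case=> [i|i]; last by rewrite (ord1 i).
  by case: i => -[|[|[|[|//]]]] ?.
move=> i j; rewrite sp => ip jp.
have valp n : (n < 5)%N -> val (nth (exist _ o (N o (mem_head _ _))) p n)
    = nth o [:: o; u; a; b; c] n.
  by move=> n5; rewrite -pE (nth_map (exist _ o (N o (mem_head _ _)))) ?sp.
rewrite [LHS](_ : _ = adj (nth o [:: o; u; a; b; c] i) (nth o [:: o; u; a; b; c] j)); last first.
  by rewrite -!valp.
move: ip jp; case: i => [|[|[|[|[|//]]]]] _; case: j => [|[|[|[|[|//]]]]] _ /=;
  rewrite ?adj_irrefl// ?(adj_sym u) ?adj_o ?adj_a ?adj_b ?adj_c !inE ?eqxx ?neqE ?orbT//.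
Qed.

Lemma pendant_K4_of_nbhds : pendant_K4_at o.
Proof.
exists C, u; split; last exact: nbhd_iso.
  split; [exact: pendant_clique|exact: card_pendant_clique|by rewrite mem_C eqxx|].
  apply/setP => -[v w]; rewrite !inE /= -!mem_C xpair_eqE.
  case: (boolP (v \in C)) => [vC|vC] /=.
    case: (boolP (w \in C)) => [wC|wC] /=; last exact: pendant_cut.
    by case: (w =P u) => [wu|]; rewrite ?andbF//; move: wC; rewrite wu (negPf u_notin_C).
  by case: eqP => // vo; move: vC; rewrite vo mem_C eqxx.
split; first exact: rest_connected.
exists u' => //; exists (@ord0 3).
pose f (v : edge_join (@ord0 3 : complete_graph 4) u') : G :=
  match v with inl i => nth o [:: o; a; b; c] i | inr v => val v end.
have fC i : f (inl i) \in C.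
  by rewrite inE mem_nth.
have fnC v : f (inr v) \notin C by have := valP v; rewrite inE.
have o'E i : (f (inl i) == o) = (i == ord0).
  by rewrite -val_eqE -(@nth_uniq _ o [:: o; a; b; c]) //= !inE !neqE.
exists f; split=> //; split.
  apply: inj_card_bij.
    move=> [i|v] [j|w] fvw.
    - congr inl; apply/val_inj/eqP.
      rewrite -(@nth_uniq _ o [:: o; a; b; c]) ?ltn_ord ?fvw//=; last by rewrite !inE !neqE.
      by apply/eqP.
    - by have := fnC w; rewrite -fvw fC.
    - by have := fnC v; rewrite fvw fC.
    - by congr inr; exact: val_inj.
  rewrite card_sum card_ord card_sig -card_pendant_clique.
  by rewrite -[leqLHS](cardsC C) leq_add2l; apply: eq_leq; apply: eq_card.
move=> [i|v] [j|w] /=.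
- have ii := ltn_ord i; have jj := ltn_ord j.
  rewrite /complete_rel -val_eqE /=; move: (val i) (val j) ii jj.
  case=> [|[|[|[|//]]]] [|[|[|[|//]]]] _ _ /=;
    by rewrite ?adj_irrefl ?adj_o ?adj_a ?adj_b ?adj_c ?inE ?eqxx ?neqE ?orbT.
- by rewrite (pendant_cut (fC i) (fnC w)) o'E.
- by rewrite adj_sym (pendant_cut (fC j) (fnC v)) o'E.
- by [].
Qed.

End PendantK4.

(** The order in which the search meets the vertices of $D+_sP_3$: the two
    vertices of degree 3 in $D$, then $s$, the other vertex of $D$, and the path
    from its attached end. *)
Definition exceptional_list : seq D_plus_P3 :=
  [:: inl (@Ordinal 4 2 isT); inl (@Ordinal 4 3 isT); inl (@Ordinal 4 0 isT);
      inl (@Ordinal 4 1 isT); inr (@Ordinal 3 0 isT); inr (@Ordinal 3 1 isT);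
      inr (@Ordinal 3 2 isT)].

Definition exceptional_default : D_plus_P3 := inr (@Ordinal 3 0 isT).

Lemma exceptional_pairsE i j : (i < 7)%N -> (j < 7)%N ->
  nth None (nth [::] exceptional_pairs i) j =
  Some (adj (nth exceptional_default exceptional_list i)
            (nth exceptional_default exceptional_list j)).
Proof.
move=> i7 j7; move: i i7 => [|[|[|[|[|[|[|//]]]]]]] _;
  by move: j j7 => [|[|[|[|[|[|[|//]]]]]]] _; reflexivity.
Qed.

Lemma mem_exceptional_list v : v \in exceptional_list.
Proof.
by case: v => [[[|[|[|[|//]]]] ?]|[[|[|[|//]]] ?]].
Qed.

Lemma nth_set_pair P i j b i' j' :
  nth None (nth [::] (set_pair P i j b) i') j' =
  if (i' == i) && (j' == j) then Some b else nth None (nth [::] P i') j'.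
Proof.
rewrite /set_pair nth_set_nth /=; case: (eqVneq i' i) => [->|] //=.
by rewrite nth_set_nth /=; case: eqP.
Qed.

Lemma size_set_pair P i j b k : (i < k)%N -> size P = k ->
  size (set_pair P i j b) = k.
Proof. by move=> ik sP; rewrite size_set_nth sP; apply/maxn_idPr. Qed.

Lemma size_row_set_pair P i j b k i' : (j < k)%N ->
  size (nth [::] P i) = k -> size (nth [::] P i') = k ->
  size (nth [::] (set_pair P i j b) i') = k.
Proof.
move=> jk si si'; rewrite /set_pair nth_set_nth /=; case: eqP => // _.
by rewrite size_set_nth si; apply/maxn_idPr.
Qed.

(** * The neighbourhood of a master vertex *)

(** [P] is the sum of squares over at least six neighbours of the master vertex,
    whose weights lie between $D/\lambda$ and $D$ and have sum $D\lambda$; [F] and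
    [QF] belong to the vertices at distance at least two. The claim reduces to
    $4\lambda^3-13\lambda^2-38\lambda+126>0$. *)
Lemma wide_star_bound (R : realFieldType) (D lam P d F QF : R) :
  0 < D -> 2 <= lam -> 6 <= d -> 0 <= F -> QF <= D * F ->
  lam * P <= D ^+ 2 * (lam ^+ 2 + lam - d) ->
  21 * (D ^+ 2 + P + QF) <= 4 * (D + D * lam + F) ^+ 2.
Proof.
move=> D0 lam2 d6 F0 QF_le PP.
have lam0 : 0 < lam by lra.
(* The cubic exceeds this product, which is nearly tangent to zero at its
   minimum $19/6$, by a positive constant. *)
have H2 : 0 <= D ^+ 2 * ((lam - 19%:R / 6%:R) ^+ 2 * (4 * lam + 37%:R / 3%:R)).
  apply: mulr_ge0; first exact: sqr_ge0.
  by apply: mulr_ge0; [exact: sqr_ge0|lra].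
have H3 : 0 <= D ^+ 2 * (d - 6) by apply: mulr_ge0; [exact: sqr_ge0|lra].
have H4 : 0 <= D ^+ 2 by exact: sqr_ge0.
have H5 : 0 <= 4 * (D + D * lam) ^+ 2 - 21 * (D ^+ 2 + P).
  rewrite -(pmulr_rge0 _ lam0); lra.
have H6 : 0 <= F * (D * (8 * lam - 13)).
  by apply: mulr_ge0 => //; apply: mulr_ge0; [exact: ltW|lra].
have H7 : 0 <= F ^+ 2 by exact: sqr_ge0.
lra.
Qed.

Lemma concave_ge_end (R : realFieldType) (q l h y : R) : l <= y <= h ->
  (21 * (l + h) <= q -> l * (q - 21 * l) <= y * (q - 21 * y)) /\
  (q <= 21 * (l + h) -> h * (q - 21 * h) <= y * (q - 21 * y)).
Proof.
case/andP=> ly yh; split=> hq; rewrite -subr_ge0.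
  have -> : y * (q - 21 * y) - l * (q - 21 * l)
    = (y - l) * ((q - 21 * (l + h)) + 21 * (h - y)) by ring.
  by apply: mulr_ge0; lra.
have -> : y * (q - 21 * y) - h * (q - 21 * h)
    = (h - y) * ((21 * (l + h) - q) + 21 * (y - l)) by ring.
by apply: mulr_ge0; lra.
Qed.

(** [x] is a Perron vector, scaled to the weight [scale] at its master vertex
    [o], with effective order below $21/4$. *)
Section Sound.
Variables (R : realType) (G : sgraph) (x : G -> R) (lam : R) (o : G).
Local Notation D := (zr R scale).
Hypothesis x_pos : forall v, 0 < x v.
Hypothesis x_o : x o = D.
Hypothesis x_max : forall v, x v <= x o.
Hypothesis x_eig : forall v, lam * x v = \sum_(w | adj v w) x w.
Hypothesis x_conc : 4 * (\sum_v x v) ^+ 2 < 21 * \sum_v x v ^+ 2.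
Hypothesis conn : graph_connected G.
Hypothesis card_G : (7 <= #|G|)%N.
Hypothesis not_exceptional : ~ isomorphic G D_plus_P3.

Let D0 : 0 < D.
Proof. by rewrite -x_o. Qed.

Let x_le v : x v <= D.
Proof. by rewrite -x_o. Qed.

Lemma eig_scaled v : D * lam * x v = D * \sum_(w | adj v w) x w.
Proof. by rewrite -mulrA x_eig. Qed.

Lemma lam_scaled : D * lam = \sum_(w | adj o w) x w.
Proof. by rewrite -x_eig x_o mulrC. Qed.

Lemma master_has_nbr : exists v, adj o v.
Proof.
case: (pickP (adj o)) => [v ov|no]; first by exists v.
have all_o v : v = o.
  by move: v; apply: (@connected_ind G (fun v => v = o) o conn) => // v w ->; rewrite no.
move: card_G; rewrite (eq_card (B := pred1 o)) ?card1// => v.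
by rewrite !inE (all_o v) eqxx.
Qed.

Lemma lam_nbr v : adj o v -> D <= lam * x v.
Proof.
move=> ov; rewrite x_eig (bigD1 o) ?(adj_sym v)//= x_o lerDl.
by apply: sumr_ge0 => w _; exact: ltW.
Qed.

Lemma lam_ge1 : 1 <= lam.
Proof.
have [v /lam_nbr vD] := master_has_nbr.
by rewrite -(ler_pM2r (x_pos v)) mul1r (le_trans (x_max v))// x_o.
Qed.

Lemma lam_le_deg : lam <= #|[pred w | adj o w]|%:R.
Proof.
rewrite -(ler_pM2l D0) lam_scaled.
rewrite (@le_trans _ _ (\sum_(w | adj o w) D))//.
  by apply: ler_sum => w _; rewrite -x_o.
by rewrite sumr_const mulr_natr.
Qed.

Lemma sum_split : \sum_v x v =
  D + D * lam + \sum_(v | (v != o) && ~~ adj o v) x v.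
Proof.
rewrite (bigD1 o)//= (bigID [pred v | adj o v])/= addrA x_o lam_scaled.
congr (_ + _ + _); apply: eq_bigl => v.
by case: eqP => // ->; rewrite adj_irrefl.
Qed.

Lemma sum_sqr_split : \sum_v x v ^+ 2 =
  D ^+ 2 + \sum_(w | adj o w) x w ^+ 2 + \sum_(v | (v != o) && ~~ adj o v) x v ^+ 2.
Proof.
rewrite (bigD1 o)//= (bigID [pred v | adj o v])/= addrA x_o.
congr (_ + _ + _); apply: eq_bigl => v.
by case: eqP => // ->; rewrite adj_irrefl.
Qed.

Lemma lam_lt : 4 * lam < 17.
Proof.
move: x_conc; set S := \sum_v x v; set Q := \sum_v x v ^+ 2 => conc.
have QS : Q <= D * S.
  rewrite mulr_sumr; apply: ler_sum => v _.
  by rewrite expr2 ler_pM2r// -x_o.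
have S0 : D + D * lam <= S.
  by rewrite [S]sum_split lerDl sumr_ge0// => v _; exact: ltW.
have Spos : 0 < S by rewrite (lt_le_trans _ S0)// addr_gt0// mulr_gt0// (lt_le_trans ltr01 lam_ge1).
have : 4 * S < 21 * D by rewrite -(ltr_pM2r Spos); lra.
move=> SD; rewrite -(ltr_pM2l D0); lra.
Qed.

(** Summing $(D-x_w)(\lambda x_w-D)\ge 0$ over the neighbours $w$ of [o] bounds
    their sum of squares by their number; with six neighbours the squares are
    too small for $\Gamma<21/4$. *)
Lemma master_deg_lt6 : (#|[pred w | adj o w]| < 6)%N.
Proof.
rewrite ltnNge; apply/negP => d6.
have lam1 := lam_ge1.
set d := #|[pred w | adj o w]| in d6.
have d6' : 6 <= d%:R :> R by rewrite (ler_nat R 6).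
have lam2 : D * d%:R <= D * lam ^+ 2.
  have -> : D * lam ^+ 2 = \sum_(w | adj o w) lam * x w.
    by rewrite -mulr_sumr -lam_scaled; ring.
  rewrite mulr_natr -sumr_const; apply: ler_sum => w; exact: lam_nbr.
have lam6 : 6 <= lam ^+ 2.
  by rewrite -(ler_pM2l D0) (le_trans _ lam2)// ler_pM2l.
set P := \sum_(w | adj o w) x w ^+ 2.
have PP : lam * P <= D ^+ 2 * (lam ^+ 2 + lam - d%:R).
  have -> : D ^+ 2 * (lam ^+ 2 + lam - d%:R)
    = \sum_(w | adj o w) ((lam + 1) * D * x w - D ^+ 2).
    rewrite sumrB -mulr_sumr -lam_scaled sumr_const -[D ^+ 2 *+ _]mulr_natr.
    rewrite -/d; ring.
  rewrite mulr_sumr; apply: ler_sum => w ow; rewrite -subr_ge0.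
  have -> : (lam + 1) * D * x w - D ^+ 2 - lam * x w ^+ 2
    = (D - x w) * (lam * x w - D) by ring.
  by rewrite mulr_ge0// subr_ge0 -?x_o// x_o; exact: lam_nbr.
have F0 : 0 <= \sum_(v | (v != o) && ~~ adj o v) x v.
  by apply: sumr_ge0 => v _; exact: ltW.
have QF : \sum_(v | (v != o) && ~~ adj o v) x v ^+ 2
    <= D * \sum_(v | (v != o) && ~~ adj o v) x v.
  rewrite mulr_sumr; apply: ler_sum => v _.
  by rewrite expr2 ler_pM2r// -x_o.
move: x_conc; rewrite sum_split sum_sqr_split -/P.
move: F0 QF; set F := \sum_(v | _) x v; set QF := \sum_(v | _) x v ^+ 2.
move=> F0 QF_le conc.
have lam_ge : 2 <= lam.
  rewrite leNgt; apply/negP => lam2'.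
  have : 0 < (2 - lam) * (2 + lam) by apply: mulr_gt0; lra.
  lra.
by move: conc; rewrite ltNge (wide_star_bound D0 lam_ge d6').
Qed.

(** * Soundness of the search *)

(** [p] lists the master vertex, its neighbours by decreasing weight, and then
    the vertices found later. *)
Record fits (d : nat) (s : pattern) (p : seq G) : Prop := {
  fits_uniq : uniq p;
  fits_lo_size : size (lo s) = size p;
  fits_hi_size : size (hi s) = size p;
  fits_pairs_size : size (pairs s) = size p;
  fits_row_size : forall i, (i < size p)%N -> size (pair_row s i) = size p;
  fits_sat_size : size (saturated s) = size p;
  fits_deg : (d < size p)%N;
  fits_head : nth o p 0 = o;
  fits_nbr : forall i, (i < size p)%N -> adj o (nth o p i) = (0 < i <= d)%N;
  fits_nbr_in : forall w, adj o w -> w \in p;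
  fits_sorted : forall i, (0 < i < d)%N -> x (nth o p i.+1) <= x (nth o p i);
  fits_lo : forall i, (i < size p)%N -> zr R (nth Z0 (lo s) i) <= x (nth o p i);
  fits_hi : forall i, (i < size p)%N -> x (nth o p i) <= zr R (nth Z0 (hi s) i);
  fits_pair : forall i j b, (i < size p)%N -> (j < size p)%N ->
    nth None (pair_row s i) j = Some b -> adj (nth o p i) (nth o p j) = b;
  fits_sat : forall i w, (i < size p)%N -> nth false (saturated s) i ->
    adj (nth o p i) w -> w \in p;
  fits_lam_lo : zr R (lam_lo s) <= D * lam;
  fits_lam_hi : D * lam <= zr R (lam_hi s) }.

Lemma sum_nbrs_ge p v : uniq p ->
  \sum_(w <- p | adj v w) x w <= \sum_(w | adj v w) x w.
Proof.
move=> up; rewrite -big_filter big_uniq ?filter_uniq//=.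
rewrite [leRHS](bigID (fun w => w \in [seq i <- p | adj v i])) /=.
rewrite [X in _ <= X + _](eq_bigl (fun w => w \in [seq i <- p | adj v i])).
  by rewrite lerDl sumr_ge0// => w _; exact: ltW.
by move=> w; rewrite mem_filter; case: (adj v w).
Qed.

Lemma sum_nbrs_eq p v : uniq p -> (forall w, adj v w -> w \in p) ->
  \sum_(w <- p | adj v w) x w = \sum_(w | adj v w) x w.
Proof.
move=> up vp; rewrite -big_filter big_uniq ?filter_uniq//=.
apply: eq_bigl => w; rewrite mem_filter.
by case: (boolP (adj v w)) => //= /vp.
Qed.

Lemma sure_sum_le v p r l : size l = size p ->
  (forall j, (j < size p)%N -> zr R (nth Z0 l j) <= x (nth o p j)) ->
  (forall j, (j < size p)%N -> nth None r j = Some true -> adj v (nth o p j)) ->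
  zr R (sure_sum r l) <= \sum_(w <- p | adj v w) x w.
Proof.
elim: p r l => [|w p IH] r [|a l] //=; first by rewrite big_nil zr0.
move=> [sl] hl hr; rewrite big_cons.
have {}IH : zr R (sure_sum (behead r) l) <= \sum_(j <- p | adj v j) x j.
  apply: IH => // [j /(hl j.+1)//|j jp rj]; apply: (hr j.+1) => //.
  by rewrite -nth_behead.
have := hl 0%N isT; have := hr 0%N isT; rewrite nth0 /=.
case: (head None r) => [[] h0 hx|_ _].
- by rewrite (h0 erefl) zrD lerD.
- by case: ifP => // _; rewrite (le_trans IH)// lerDr ltW.
- by case: ifP => // _; rewrite (le_trans IH)// lerDr ltW.
Qed.

Lemma possible_sum_ge v p r h : size h = size p ->
  (forall j, (j < size p)%N -> x (nth o p j) <= zr R (nth Z0 h j)) ->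
  (forall j, (j < size p)%N -> nth None r j = Some false ->
     ~~ adj v (nth o p j)) ->
  \sum_(w <- p | adj v w) x w <= zr R (possible_sum r h).
Proof.
elim: p r h => [|w p IH] r [|a h] //=; first by rewrite big_nil zr0.
move=> [sl] hl hr; rewrite big_cons.
have {}IH : \sum_(j <- p | adj v j) x j <= zr R (possible_sum (behead r) h).
  apply: IH => // [j /(hl j.+1)//|j jp rj]; apply: (hr j.+1) => //.
  by rewrite -nth_behead.
have hx := hl 0%N isT; have := hr 0%N isT; rewrite nth0 /=.
have a0 : 0 <= zr R a by rewrite (le_trans _ hx)// ltW.
case: (head None r) => [[] h0|_].
- by rewrite zrD; case: ifP => _; rewrite ?lerD// (le_trans IH)// lerDr.
- by rewrite (negPf (h0 erefl)).
- by rewrite zrD; case: ifP => _; rewrite ?lerD// (le_trans IH)// lerDr.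
Qed.

Let lam_pos : 0 < lam.
Proof. exact: lt_le_trans lam_ge1. Qed.

Lemma lam_hi_gt0 d s p : fits d s p -> 0 < zr R (lam_hi s).
Proof. by move=> re; apply: lt_le_trans (fits_lam_hi re); rewrite mulr_gt0. Qed.

Lemma tighten_sound d s p : fits d s p -> fits d (tighten d s) p.
Proof.
move=> re.
have ls := fits_lo_size re.
split; try (by case: re); rewrite ?size_mkseq//.
- move=> i ip /=; rewrite nth_mkseq ?ls// /tighter_lo.
  have H : zr R (Z.max (nth Z0 (lo s) i)
             (Z.div (Z.mul scale (sure_sum (pair_row s i) (lo s))) (lam_hi s)))
           <= x (nth o p i).
    apply: zr_max; first exact: fits_lo re _ ip.
    apply: zr_div_lo; first by apply: (lam_hi_gt0 re).
    rewrite zrM (@le_trans _ _ (D * lam * x (nth o p i)))//; last first.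
      by rewrite ler_pM2r//; exact: fits_lam_hi re.
    rewrite eig_scaled ler_pM2l ?D0//.
    apply: le_trans (sum_nbrs_ge _ (fits_uniq re)).
    apply: sure_sum_le => // [j|j jp]; first exact: fits_lo re _.
    by move/(fits_pair re ip jp).
  case: ifP => // id; apply: zr_max => //.
  apply: le_trans (fits_sorted re id); apply: (fits_lo re).
  by apply: leq_ltn_trans (fits_deg re); case/andP: id.
- move=> i ip /=; rewrite nth_mkseq ?ls// /tighter_hi.
  set a := (if nth false _ _ then _ else _).
  have H : x (nth o p i) <= zr R a.
    rewrite /a; case: ifP => ci; last exact: fits_hi re _ ip.
    case: Z.ltb_spec => L0; last exact: fits_hi re _ ip.
    apply: zr_min; first exact: fits_hi re _ ip.
    apply: zr_div_hi; first exact: (zr_gt0 R L0).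
    rewrite zrM (@le_trans _ _ (D * lam * x (nth o p i)))//.
      by rewrite ler_pM2r//; exact: fits_lam_lo re.
    rewrite eig_scaled ler_pM2l ?D0//.
    rewrite -(sum_nbrs_eq (fits_uniq re) (fun w => fits_sat re ip ci)).
    apply: possible_sum_ge => // [|j|j jp]; first exact: fits_hi_size re.
      exact: fits_hi re _.
    by move/(fits_pair re ip jp) => ->.
  case: ifP => // id; apply: zr_min => //.
  case: i ip @a H id => [|i] ip a H id //.
  apply: (le_trans (fits_sorted re _)); first by lia.
  by apply: (fits_hi re); lia.
Qed.

Lemma infeasible_sound d s p : fits d s p -> infeasible s = false.
Proof.
move=> re; apply/hasPn => i; rewrite mem_iota /= add0n (fits_lo_size re) => ip.
apply/negP => /Z.ltb_lt /(zr_lt R); apply/negP; rewrite -leNgt.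
by apply: le_trans (fits_lo re ip) (fits_hi re ip).
Qed.

Lemma foldr_max_le (f : nat -> Z) (l : seq nat) (b : Z) (y : R) :
  zr R b <= y -> {in l, forall i, zr R (f i) <= y} ->
  zr R (foldr (fun i t => Z.max (f i) t) b l) <= y.
Proof.
move=> by_; elim: l => //= i l IH fl; apply: zr_max.
  by apply: fl; rewrite mem_head.
by apply: IH => j jl; apply: fl; rewrite in_cons jl orbT.
Qed.

Lemma forced_outside_le d s p v : fits d s p -> (v < size p)%N ->
  zr R (forced_outside s v) <= \sum_(w | w \notin p) x w.
Proof.
move=> re vp; rewrite /forced_outside; case: ifP => _.
  by rewrite zr0; apply: sumr_ge0 => w _; exact: ltW.
set l := Z.max 0 _; have l0 : 0 <= zr R l by apply: zr_ge0; rewrite /l; lia.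
have lx : zr R l <= x (nth o p v).
  by apply: zr_max; [rewrite zr0 ltW|exact: fits_lo re _ vp].
rewrite zrB lerBlDr.
have in_p : \sum_(w <- p | adj (nth o p v) w) x w
    <= zr R (possible_sum (pair_row s v) (hi s)).
  apply: possible_sum_ge => // [|j|j jp]; first exact: fits_hi_size re.
    exact: fits_hi re _.
  by move/(fits_pair re vp jp) => ->.
rewrite (@le_trans _ _ (lam * x (nth o p v)))//.
  apply: zr_div_lo => //; rewrite zrM mulrA.
  apply: le_trans (_ : D * lam * zr R l <= _); last first.
    by rewrite ler_wpM2l// ltW// mulr_gt0.
  by rewrite ler_wpM2r//; exact: fits_lam_lo re.
rewrite x_eig (bigID (mem p))/= addrC lerD//.
  rewrite [leLHS]big_mkcond [leRHS]big_mkcond; apply: ler_sum => w _.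
  by case: (w \in p); case: adj => //=; exact: ltW.
apply: le_trans in_p; rewrite -[leRHS]big_filter [leRHS]big_uniq; last first.
  by rewrite filter_uniq ?(fits_uniq re).
rewrite (eq_bigl (fun w => w \in [seq i <- p | adj (nth o p v) i])) //.
by move=> w; rewrite mem_filter.
Qed.

Lemma next_outside_le d s p : fits d s p ->
  zr R (next_outside s) <= \sum_(w | w \notin p) x w.
Proof.
move=> re; rewrite /next_outside (fits_lo_size re); case: ifP => [p7|_]; last first.
  by rewrite zr0; apply: sumr_ge0 => w _; exact: ltW.
have [i [w [ip piw wp]]] : exists i w,
    [/\ (i < size p)%N, adj (nth o p i) w & w \notin p].
  case: (pickP [pred iw : 'I_(size p) * G |
      adj (nth o p iw.1) iw.2 && (iw.2 \notin p)]) => [[i w] /= /andP[a b]|no].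
    by exists i, w; split; rewrite ?ltn_ord.
  have all_p v : v \in p.
    move: v; apply: (@connected_ind G (fun v => v \in p) o conn).
      by rewrite -(fits_head re) mem_nth// (leq_ltn_trans _ (fits_deg re)).
    move=> v w vp vw; apply: contraFT (no (Ordinal (etrans (index_mem v p) vp), w)) => wp.
    by rewrite /= nth_index// vw.
  have sp : size p = #|G|.
    by rewrite -(card_uniqP (fits_uniq re)); apply: eq_card => v; rewrite all_p.
  by move: p7; rewrite sp ltnNge card_G.
rewrite (bigD1 w)//; apply: (@le_trans _ _ (x w)); last first.
  by rewrite lerDl; apply: sumr_ge0 => v _; exact: ltW.
apply: zr_div_lo; first exact: lam_hi_gt0 re.
rewrite zrM (@le_trans _ _ (D * lam * x w))//; last first.
  by apply: ler_wpM2r; [exact: ltW|exact: fits_lam_hi re].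
rewrite -mulrA ler_pM2l// x_eig (bigD1 (nth o p i)) 1?adj_sym//=.
rewrite (@le_trans _ _ (x (nth o p i)))//; last first.
  by rewrite lerDl; apply: sumr_ge0 => v _; exact: ltW.
have : i \in iota 0 (size p) by rewrite mem_iota.
elim: (iota 0 (size p)) => //= j l IH; rewrite in_cons => /orP[/eqP <-|/IH le_l].
  case: ifP => [sat|_]; first by have := fits_sat re ip sat piw; rewrite (negPf wp).
  apply: le_trans (fits_lo re ip); apply: zr_le; lia.
by case: ifP => // _; apply: le_trans le_l; apply: zr_le; lia.
Qed.

Lemma outside_le d s p : fits d s p ->
  zr R (outside s) <= \sum_(w | w \notin p) x w.
Proof.
move=> re; rewrite /outside; set b := foldr _ _ _.
apply: (@le_trans _ _ (zr R b)); first by apply: zr_le; lia.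
apply: foldr_max_le => [|i].
  apply: zr_max; last exact: next_outside_le re.
  by rewrite zr0; apply: sumr_ge0 => w _; exact: ltW.
by rewrite mem_iota (fits_lo_size re) => ip; exact: forced_outside_le re ip.
Qed.

Lemma outside_bounds s : 0 <= zr R (outside s) <= D.
Proof.
rewrite /outside zr_le ?andbT; last by lia.
apply: zr_ge0; set b := foldr _ _ _.
have : Z.le 0 b by rewrite /b; elim: (iota 0 _) => [|i l IH] /=; lia.
by rewrite /scale; lia.
Qed.

(** If all weights are below [M], a total mass [M] contributes at least as much
    as when concentrated in one vertex: compare the concave function with its
    chord from 0 to [M]. Otherwise one weight lies between [M] and [D], and
    contributes at least as much as one of these ends. *)
Lemma concave_sum_ge (P : pred G) (T M y : R) : 0 <= M <= D -> 21 * D <= 8 * T ->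
  M <= \sum_(v | P v) x v ->
  y <= M * (8 * T - 21 * M) -> y <= D * (8 * T - 21 * D) ->
  y <= \sum_(v | P v) x v * (8 * T - 21 * x v).
Proof.
move=> /andP[M0 MD] TD MP yM yD.
have f0 v : 0 <= x v * (8 * T - 21 * x v).
  apply: mulr_ge0; first exact: ltW.
  by rewrite subr_ge0 (le_trans _ TD)// ler_pM2l// ltr0n.
case: (pickP [pred v | P v && (M <= x v)]) => [v /= /andP[Pv Mv]|small].
  rewrite (bigD1 v)//= -[y]addr0 lerD//; last by apply: sumr_ge0 => w _.
  have MxD : M <= x v <= D by rewrite Mv x_le.
  have [H1 H2] := concave_ge_end (8 * T) MxD.
  by case: (lerP (21 * (M + D)) (8 * T)) => [/H1|/ltW /H2]; apply: le_trans.
apply: (le_trans yM).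
apply: (@le_trans _ _ ((\sum_(v | P v) x v) * (8 * T - 21 * M))).
  by apply: ler_wpM2r => //; lra.
rewrite mulr_suml; apply: ler_sum => v Pv.
have /negbT := small v; rewrite /= Pv /= -ltNge => /ltW vM.
apply: ler_wpM2l; first exact: ltW.
by lra.
Qed.

Lemma sum_seq (F : G -> R) p :
  \sum_(w <- p) F w = \sum_(0 <= i < size p) F (nth o p i).
Proof. by rewrite (big_nth o). Qed.

Lemma spread_sound d s p : fits d s p -> spread d s = false.
Proof.
move=> re; apply/negP; rewrite /spread.
move: (tangency d s) => t; case: Z.leb_spec => // t21 /hasP [m m_in].
set y := Z.min _ _.
case: Z.leb_spec => // mar _.
have m0 : Z.le 0 m.
  by move: m_in; rewrite !inE; repeat case/orP; move=> /eqP ->.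
move: mar; rewrite /margin (fits_lo_size re).
set mu := Z.mul 4 (Z.mul scale m); set k := size p.
set e := (fun i => if nth _ (mkseq _ _) i then nth Z0 (hi s) i else _).
set T := zr R t.
pose q i := 8 * T - (if (0 < i <= d)%N then zr R mu else 0).
have e_le i : (i < k)%N ->
    zr R (e i) * (q i - 21 * zr R (e i))
    <= x (nth o p i) * (q i - 21 * x (nth o p i)).
  move=> ik; rewrite /e nth_mkseq// /worst_is_hi.
  have lh : zr R (nth Z0 (lo s) i) <= x (nth o p i) <= zr R (nth Z0 (hi s) i).
    by rewrite (fits_lo re)// (fits_hi re).
  have [H1 H2] := concave_ge_end (q i) lh.
  have qz : q i = zr R (Z.sub (Z.mul 8 t) (if (0 < i <= d)%N then mu else Z0)).
    by rewrite /q zrB zrM (zr_nat R 8); case: ifP; rewrite ?zr0.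
  case: Z.ltb_spec => [/(zr_lt R)|/(zr_le R)]; rewrite zrM zrD (zr_nat R 21) -qz => hq.
    by apply: H2; apply: ltW.
  exact: H1.
have sum_e : \sum_(0 <= i < k) zr R (e i) * (q i - 21 * zr R (e i))
    <= \sum_(0 <= i < k) x (nth o p i) * (q i - 21 * x (nth o p i)).
  by rewrite !big_mkord; apply: ler_sum => i _; exact: e_le.
have split_q (f : nat -> R) :
    \sum_(0 <= i < k) f i * (q i - 21 * f i) = 8 * T * \sum_(0 <= i < k) f i
      - zr R mu * (\sum_(0 <= i < k) if (0 < i <= d)%N then f i else 0)
      - 21 * \sum_(0 <= i < k) f i ^+ 2.
  rewrite !mulr_sumr -!sumrB; apply: eq_bigr => i _; rewrite /q.
  by case: ifP => _; ring.
(* This equality is what the multiplier [mu] is paired with. *)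
have lamE : \sum_(0 <= i < k) (if (0 < i <= d)%N then x (nth o p i) else 0)
    = D * lam.
  rewrite lam_scaled -(sum_nbrs_eq (fits_uniq re) (@fits_nbr_in _ _ _ re)) (big_nth o).
  rewrite [RHS]big_mkcond !big_mkord; apply: eq_bigr => i _.
  by rewrite (fits_nbr re).
rewrite !split_q lamE in sum_e.
have TD : 21 * D <= 8 * T.
  by have := zr_le R t21; rewrite !zrM (zr_nat R 21) (zr_nat R 8).
have out : 8 * T * (\sum_(0 <= i < k) x (nth o p i))
      - 21 * (\sum_(0 <= i < k) x (nth o p i) ^+ 2) + zr R y
    <= 8 * T * (\sum_v x v) - 21 * \sum_v x v ^+ 2.
  rewrite -(sum_seq x) -(sum_seq (fun v => x v ^+ 2)) !mulr_sumr -!sumrB.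
  rewrite big_uniq ?(fits_uniq re)//= [leRHS](bigID (mem p))/= lerD2l.
  rewrite [leRHS](eq_bigr (fun v => x v * (8 * T - 21 * x v))); last first.
    by move=> v _; ring.
  apply: (concave_sum_ge (outside_bounds s) TD (outside_le re)).
    rewrite -(zr_nat R 8) -(zr_nat R 21) -!zrM -zrB -zrM; apply: zr_le; lia.
  rewrite -(zr_nat R 8) -(zr_nat R 21) -!zrM -zrB -zrM; apply: zr_le; lia.
move/(zr_le R).
rewrite zrD zrB !zrD !zrM !zrB !zrM !zr_sum -/T.
have -> : \sum_(0 <= i < k) zr R (if (0 < i <= d)%N then e i else Z0)
    = \sum_(0 <= i < k) if (0 < i <= d)%N then zr R (e i) else 0.
  by apply: eq_bigr => i _; case: ifP; rewrite ?zr0.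
have -> : \sum_(0 <= i < k) zr R (if nth false (mkseq (worst_is_hi d s t mu) k) i
      then nth Z0 [seq Z.mul a a | a <- hi s] i
      else nth Z0 [seq Z.mul a a | a <- lo s] i)
    = \sum_(0 <= i < k) zr R (e i) ^+ 2.
  rewrite !big_mkord; apply: eq_bigr => i _; rewrite /e expr2 -zrM.
  by case: ifP => _; rewrite (nth_map Z0) ?(fits_lo_size re) ?(fits_hi_size re).
move: sum_e out x_conc.
set E := \sum_(0 <= i < k) zr R (e i).
set EN := \sum_(0 <= i < k) if _ then zr R (e i) else 0.
set E2 := \sum_(0 <= i < k) zr R (e i) ^+ 2.
set S := \sum_v x v; set Q := \sum_v x v ^+ 2.
move=> sum_e out conc mar.
have muE : zr R mu = 4 * (D * zr R m) by rewrite !zrM (zr_nat R 4).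
have mu0 : 0 <= zr R mu by rewrite muE; apply: mulr_ge0; [|apply: mulr_ge0; [exact: ltW D0|exact: zr_ge0]].
have muL : zr R mu * zr R (lam_lo s) <= zr R mu * (D * lam).
  by rewrite ler_wpM2l//; exact: fits_lam_lo re.
(* Convexity in [S]: the tangent at [T] lies below the square. *)
have sq : 0 <= (S - T) ^+ 2 by exact: sqr_ge0.
have mar' : 0 <= 4 * (T * (2 * E - T)) + (zr R mu * zr R (lam_lo s) - zr R mu * EN)
    - 21 * E2 + zr R y.
  rewrite muE; move: mar.
  rewrite (zr_nat R 4) (zr_nat R 2) (zr_nat R 21) zr0.
  lra.
lra.
Qed.

Lemma split_lam_sound d s p (P : pred pattern) : fits d s p ->
  all P (split_lam s) -> exists t, P t /\ fits d t p.
Proof.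
rewrite /split_lam /= andbT; move: (Z.div _ _) => m re /andP[P1 P2].
case: (leP (D * lam) (zr R m)) => [le|/ltW le].
  by eexists; split; [exact: P1|split; case: re].
by eexists; split; [exact: P2|split; case: re].
Qed.

Lemma split_weight_sound d s p i (P : pred pattern) : fits d s p ->
  (i < size p)%N ->
  all P (split_weight i s) -> exists t, P t /\ fits d t p.
Proof.
rewrite /split_weight /= andbT; move: (Z.div _ _) => m re ip /andP[P1 P2].
case: (leP (x (nth o p i)) (zr R m)) => [le|/ltW le].
  eexists; split; [exact: P1|split; try by case: re].
    by rewrite size_set_nth (fits_hi_size re); apply/maxn_idPr.
  move=> j jp /=; rewrite nth_set_nth /=; case: eqP => [->//|_].
  exact: fits_hi re _ jp.
eexists; split; [exact: P2|split; try by case: re].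
  by rewrite size_set_nth (fits_lo_size re); apply/maxn_idPr.
move=> j jp /=; rewrite nth_set_nth /=; case: eqP => [->//|_].
exact: fits_lo re _ jp.
Qed.

Lemma split_pair_sound d s p i j (P : pred pattern) : fits d s p ->
  (i < size p)%N -> (j < size p)%N ->
  all P (split_pair i j s) -> exists t, P t /\ fits d t p.
Proof.
move=> re ip jp; rewrite /split_pair /= andbT => Pt.
set b := adj (nth o p i) (nth o p j).
exists (Pattern (lo s) (hi s) (set_pair (set_pair (pairs s) i j b) j i b)
  (saturated s) (lam_lo s) (lam_hi s)); split.
  by case: b; case/andP: Pt.
have sr k : (k < size p)%N -> size (nth [::] (pairs s) k) = size p.
  by move=> kp; exact: fits_row_size re _ kp.
split; try by case: re.
- by rewrite /= (@size_set_pair _ _ _ _ (size p))// (@size_set_pair _ _ _ _ (size p))// (fits_pairs_size re).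
- move=> k kp; rewrite /pair_row /=; apply: size_row_set_pair => //;
    by apply: size_row_set_pair => //; exact: sr.
- move=> k l c kp lp; rewrite /pair_row /= !nth_set_pair.
  case: ifP => [/andP[/eqP-> /eqP->] [<-]|_].
    by rewrite /b adj_sym.
  case: ifP => [/andP[/eqP-> /eqP->] [<-]//|_].
  exact: fits_pair re _ _ _ kp lp.
Qed.

Lemma split_nbhd_sound d s p v (P : pred pattern) : fits d s p ->
  (v < size p)%N ->
  all P (split_nbhd v s) -> exists t q, P t /\ fits d t q.
Proof.
rewrite /split_nbhd /= andbT; set new := mkseq _ _ => re vp /andP[P1 P2].
case: (pickP (fun w => adj (nth o p v) w && (w \notin p))) => [w|no].
  case/andP=> vw wp; eexists; exists (rcons p w); split; [exact: P2|].
  have snew : size new = size p by rewrite size_mkseq (fits_lo_size re).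
  have szip : size (zip (pairs s) new) = size p.
    by rewrite size_zip (fits_pairs_size re) snew minnn.
  have nthp i : (i < size p)%N -> nth o (rcons p w) i = nth o p i.
    by move=> ip; rewrite nth_rcons ip.
  have nthw : nth o (rcons p w) (size p) = w by rewrite nth_rcons ltnn eqxx.
  have ow : adj o w = false.
    by apply/negP => /(fits_nbr_in re); rewrite (negPf wp).
  have rowp i : (i < size p)%N ->
      nth [::] (rcons [seq rcons r.1 r.2 | r <- zip (pairs s) new]
                 (rcons new (Some false))) i
      = rcons (pair_row s i) (nth None new i).
    move=> ip; rewrite nth_rcons size_map szip ip (nth_map ([::], None)) ?szip//.
    by rewrite nth_zip ?(fits_pairs_size re) ?snew.
  have roww : nth [::] (rcons [seq rcons r.1 r.2 | r <- zip (pairs s) new]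
                 (rcons new (Some false))) (size p) = rcons new (Some false).
    by rewrite nth_rcons size_map szip ltnn eqxx.
  have newP i b : (i < size p)%N -> nth None new i = Some b ->
      adj (nth o p i) w = b.
    move=> ip; rewrite nth_mkseq ?(fits_lo_size re)//; case: ifP => [ci [<-]|_].
      by apply/negP => /(fits_sat re ip ci); rewrite (negPf wp).
    by case: eqP => // -> [<-].
  have lt_S i : (i < (size p).+1)%N -> (i < size p)%N \/ i = size p.
    by rewrite ltnS leq_eqVlt => /orP[/eqP|]; [right|left].
  split => /=; rewrite ?size_rcons.
  - by rewrite rcons_uniq wp (fits_uniq re).
  - by rewrite (fits_lo_size re).
  - by rewrite (fits_hi_size re).
  - by rewrite size_map szip.
  - move=> i /lt_S [ip|->]; rewrite /pair_row /= ?roww ?rowp// size_rcons ?snew//.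
    by rewrite (fits_row_size re).
  - by rewrite (fits_sat_size re).
  - by rewrite ltnW// ltnS (fits_deg re).
  - by rewrite nthp ?(fits_head re)// (leq_ltn_trans _ (fits_deg re)).
  - move=> i /lt_S [ip|->]; first by rewrite nthp// (fits_nbr re).
    by rewrite nthw ow; have := fits_deg re; lia.
  - by move=> u /(fits_nbr_in re) up; rewrite mem_rcons inE up orbT.
  - move=> i id; have := fits_deg re => dp.
    by rewrite !nthp ?(fits_sorted re)//; lia.
  - move=> i /lt_S [ip|->]; first by rewrite nthp// nth_rcons (fits_lo_size re) ip (fits_lo re).
    by rewrite nthw nth_rcons (fits_lo_size re) ltnn eqxx zr0 ltW.
  - move=> i /lt_S [ip|->]; first by rewrite nthp// nth_rcons (fits_hi_size re) ip (fits_hi re).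
    by rewrite nthw nth_rcons (fits_hi_size re) ltnn eqxx -x_o.
  - move=> i j b /lt_S [ip|->] /lt_S [jp|->]; rewrite /pair_row /= ?roww ?rowp// nth_rcons.
    + by rewrite (fits_row_size re ip) jp !nthp//; exact: fits_pair re _ _ _ ip jp.
    + by rewrite (fits_row_size re ip) ltnn eqxx nthp// nthw; exact: newP.
    + by rewrite snew jp nthw nthp// adj_sym; exact: newP.
    + by rewrite snew ltnn eqxx nthw adj_irrefl => -[].
  - move=> i u /lt_S [ip|->]; rewrite nth_rcons (fits_sat_size re).
      by rewrite ip nthp// => ci /(fits_sat re ip ci); rewrite mem_rcons inE orbC => ->.
    by rewrite ltnn eqxx.
  - exact: fits_lam_lo re.
  - exact: fits_lam_hi re.
eexists; exists p; split; [exact: P1|split; try by case: re].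
  by rewrite /= size_set_nth (fits_sat_size re); apply/maxn_idPr.
move=> i w ip /=; rewrite nth_set_nth /=; case: eqP => [-> _ vw|_ ci].
  by apply: contraFT (no w); rewrite vw.
by move=> iw; exact: (fits_sat re ip ci iw).
Qed.

Lemma branch_sound d s p (P : pred pattern) : fits d s p ->
  all P (branch s) -> exists t q, P t /\ fits d t q.
Proof.
move=> re; have fix1 : forall Q : pattern -> Prop,
    (exists t, Q t /\ fits d t p) -> exists t q, Q t /\ fits d t q.
  by move=> Q [t ?]; exists t, p.
rewrite /branch (fits_lo_size re).
case: ifP => _; first by move=> /(split_lam_sound re) /fix1.
case: ifP => [/andP[ij jk]|_].
  by move=> /(split_pair_sound re (ltn_trans ij jk) jk) /fix1.
case: ifP => [|_].
  by case: ifP => // _ mk /(split_weight_sound re mk) /fix1.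
case: ifP => [/andP[vk _]|_]; first exact: split_nbhd_sound re vk.
case: ifP => _; first by move=> /(split_lam_sound re) /fix1.
case: ifP => [mk|_]; first by move=> /(split_weight_sound re mk) /fix1.
by rewrite /= andbT => Ps; exists s, p.
Qed.

Lemma terminal_sound d s p : fits d s p -> terminal s = false.
Proof.
move=> re; apply/negP; rewrite /terminal.
case: ifP => // /(all_nthP false); rewrite (fits_sat_size re) => sat.
have inp v : v \in p.
  move: v; apply: (@connected_ind G (fun v => v \in p) o conn).
    by rewrite -(fits_head re) mem_nth// (leq_ltn_trans _ (fits_deg re)).
  move=> v w vp; rewrite -(nth_index o vp).
  by apply: (fits_sat re); rewrite ?sat ?index_mem.
have sp : size p = #|G|.
  by rewrite -(card_uniqP (fits_uniq re)); apply: eq_card => v; rewrite inp.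
rewrite (fits_lo_size re) sp ltnNge card_G /=.
case: eqP => // G7 /eqP ex; apply: not_exceptional.
apply: (@isomorphic_of_lists _ _ p exceptional_list o exceptional_default) => //.
- exact: fits_uniq re.
- by rewrite sp G7.
- exact: mem_exceptional_list.
- rewrite sp G7 => i j i7 j7; apply: (fits_pair re); rewrite ?sp ?G7//.
  by rewrite /pair_row ex exceptional_pairsE.
Qed.

Lemma mem_nth_map p l m : uniq p -> (m < size p)%N -> all (gtn (size p)) l ->
  (nth o p m \in map (nth o p) l) = (m \in l).
Proof.
move=> up mp /allP lp; apply/mapP/idP => [[n nl]|ml]; last by exists m.
by have np : (n < size p)%N := lp n nl; move/eqP; rewrite nth_uniq// => /eqP ->.
Qed.

Lemma pendant_sound d s p : fits d s p -> pendant d s -> pendant_K4_at o.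
Proof.
move=> re; rewrite /pendant; case: eqP => // d4 /hasP[u u_in /allP Hall].
have p5 : (4 < size p)%N by rewrite -d4 (fits_deg re).
have nbrs v l : (v < size p)%N -> all (gtn (size p)) l ->
    (forall w, adj (nth o p v) w -> w \in p) ->
    (forall m, (m < size p)%N -> adj (nth o p v) (nth o p m) = (m \in l)) ->
    forall w, adj (nth o p v) w = (w \in map (nth o p) l).
  move=> vp lp cl ml w; case: (boolP (w \in p)) => [wp|wp].
    by rewrite -(nth_index o wp) ml ?index_mem// mem_nth_map ?(fits_uniq re) ?index_mem.
  rewrite (contraNF (@cl w) wp); apply/esym/negP => /mapP[m ml' wm].
  by case/negP: wp; rewrite wm mem_nth//; exact: (allP lp m ml').
have main i j k : uniq [:: 0; u; i; j; k]%N ->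
    all (gtn 5) [:: 0; u; i; j; k]%N ->
    rem u [:: 1; 2; 3; 4]%N = [:: i; j; k] -> pendant_K4_at o.
  move=> uq l5 rE.
  have l5p : all (gtn (size p)) [:: 0; u; i; j; k]%N.
    by apply: sub_all l5 => m /= m5; apply: leq_ltn_trans p5.
  have sub_p l : {subset l <= [:: 0; u; i; j; k]%N} -> all (gtn (size p)) l.
    by move=> sl; apply/allP => m /sl /(allP l5p).
  have adjT v l : v \in [:: i; j; k] -> {subset l <= [:: 0; u; i; j; k]%N} ->
      (forall m, (m != v) && (m \in [:: 0; i; j; k]%N) = (m \in l)) ->
      forall w, adj (nth o p v) w = (w \in map (nth o p) l).
    move=> vT ls lE.
    have vp : (v < size p)%N.
      by apply: (allP l5p v); rewrite in_cons in_cons vT !orbT.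
    have := Hall v; rewrite rE vT => /(_ isT); case: ifP => // sat /allP rowE.
    apply: nbrs => //; [exact: sub_p|by move=> w vw; exact: (fits_sat re vp sat vw)|].
    move=> m mp; rewrite -lE; apply: (fits_pair re) => //; apply/eqP.
    by apply: rowE; rewrite mem_iota /= add0n (fits_lo_size re).
  move: uq; rewrite /= !inE !negb_or.
  move=> /and5P[/and4P[u0 i0 j0 k0] /and3P[ui uj uk] /andP[ij ik] jk _].
  have hd : nth o p 0 = o := fits_head re.
  have kE m n : [:: o; nth o p m; nth o p n] = map (nth o p) [:: 0; m; n]%N.
    by rewrite /= hd.
  apply: (@pendant_K4_of_nbhds _ o (nth o p u) (nth o p i) (nth o p j) (nth o p k)) => //.
  - rewrite -{1}hd -!/(map (nth o p) [:: 0; u; i; j; k]%N).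
    rewrite (map_inj_in_uniq (f := nth o p) (s := [:: 0; u; i; j; k]%N)).
      by rewrite /= !inE !negb_or u0 i0 j0 k0 ui uj uk ij ik jk.
    move=> m n /(allP l5p) mp /(allP l5p) np /eqP.
    by rewrite nth_uniq ?(fits_uniq re)// => /eqP.
  - move=> w; rewrite -[in LHS]hd -[RHS]/(w \in map (nth o p) [:: u; i; j; k]).
    apply: nbrs.
    + by apply: leq_ltn_trans p5.
    + by apply: sub_p => m ml; rewrite in_cons ml orbT.
    + by move=> v; rewrite hd => /(fits_nbr_in re).
    + move=> m mp; rewrite hd (fits_nbr re)// d4.
      have -> : (m \in [:: u; i; j; k]) = (m \in u :: rem u [:: 1; 2; 3; 4]%N).
        by rewrite rE.
      rewrite -(perm_mem (perm_to_rem u_in)).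
      by case: m {mp} => [|[|[|[|[|m]]]]].
  - move=> w; rewrite kE; apply: (adjT i [:: 0; j; k]%N _ _ _ w).
    + by rewrite !inE eqxx.
    + by move=> m; rewrite !inE; case/or3P => ->; rewrite ?orbT.
    + move=> m; rewrite !inE; case: (eqVneq m i) => //= ->.
      by rewrite (eq_sym i) (negPf i0) (negPf ij) (negPf ik).
  - move=> w; rewrite kE; apply: (adjT j [:: 0; i; k]%N _ _ _ w).
    + by rewrite !inE eqxx orbT.
    + by move=> m; rewrite !inE; case/or3P => ->; rewrite ?orbT.
    + move=> m; rewrite !inE; case: (eqVneq m j) => [->|_] /=; rewrite ?orbF//.
      by rewrite (eq_sym j 0%N) (eq_sym j i) (negPf j0) (negPf ij) (negPf jk).
  - move=> w; rewrite kE; apply: (adjT k [:: 0; i; j]%N _ _ _ w).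
    + by rewrite !inE eqxx !orbT.
    + by move=> m; rewrite !inE; case/or3P => ->; rewrite ?orbT.
    + move=> m; rewrite !inE; case: (eqVneq m k) => [->|_] /=; rewrite ?orbF//.
      by rewrite (eq_sym k 0%N) (eq_sym k i) (eq_sym k j) (negPf k0) (negPf ik) (negPf jk).
move: u_in main; rewrite !inE => /or4P[]/eqP-> main.
- exact: (main 2 3 4).
- exact: (main 1 3 4).
- exact: (main 1 2 4).
- exact: (main 1 2 3).
Qed.

Definition sorted_nbrs : seq G :=
  sort (fun v w => x w <= x v) (enum [pred w | adj o w]).

Lemma mem_sorted_nbrs w : (w \in sorted_nbrs) = adj o w.
Proof. by rewrite mem_sort mem_enum. Qed.

Lemma start_sound : fits (size sorted_nbrs) (start (size sorted_nbrs))
  (o :: sorted_nbrs).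
Proof.
set d := size sorted_nbrs.
have dE : d = #|[pred w | adj o w]| by rewrite /d size_sort -cardE.
split.
- by rewrite /= mem_sorted_nbrs adj_irrefl sort_uniq enum_uniq.
- by rewrite /= size_nseq.
- by rewrite /= size_nseq.
- by rewrite /= size_mkseq.
- move=> [|i] /= id; rewrite /pair_row /= ?size_nseq// nth_mkseq//= size_set_nth size_nseq.
  by congr S; apply/maxn_idPr.
- by rewrite /= size_nseq.
- by [].
- by [].
- move=> [|i] /= id; first by rewrite adj_irrefl.
  by rewrite -mem_sorted_nbrs mem_nth//; apply/esym.
- by move=> w ow; rewrite in_cons mem_sorted_nbrs ow orbT.
- move=> [|i] //= id.
  apply: (@sorted_leq_nth _ (fun v w => x w <= x v) _ _ o sorted_nbrs) => //.
  + by move=> u v w uv vw; exact: le_trans vw uv.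
  + by apply: sort_sorted => v w; exact: le_total.
  + by rewrite inE ltnW.
- move=> [|i] /= id; first by rewrite x_o.
  by rewrite nth_nseq if_same zr0 ltW.
- by move=> [|i] /= id; rewrite ?nth_nseq ?(id : (i < d)%N) -?x_o.
- move=> [|i] [|j] b /= id jd; rewrite /pair_row /=.
  + by case=> <-; rewrite adj_irrefl.
  + rewrite nth_nseq (jd : (j < d)%N) => -[<-].
    by rewrite -mem_sorted_nbrs mem_nth.
  + rewrite nth_mkseq//= => -[<-].
    by rewrite adj_sym -mem_sorted_nbrs mem_nth.
  + rewrite nth_mkseq//= nth_set_nth /= nth_nseq if_same.
    by case: eqP => // -> [<-]; rewrite adj_irrefl.
- move=> [|i] w id /=; first by move=> _ ow; rewrite in_cons mem_sorted_nbrs ow orbT.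
  by rewrite nth_nseq if_same.
- by rewrite /= ler_peMr ?(ltW D0) ?lam_ge1.
- apply: zr_min.
    rewrite zrM zr_nat mulrC ler_pM2r// dE; exact: lam_le_deg.
  have -> : Z.div (Z.mul 17 scale) 4 = Z.mul 17 256 by [].
  have -> : D = 4 * zr R 256 by rewrite -(zr_nat R 4) -zrM.
  have : 0 <= zr R 256 * (17 - 4 * lam).
    by apply: mulr_ge0; [exact: zr_ge0|have := lam_lt; lra].
  rewrite zrM (zr_nat R 17); lra.
Qed.

Lemma search_sound fuel d s p : fits d s p -> search d fuel s -> pendant_K4_at o.
Proof.
elim: fuel s p => //= fuel IH s p re.
have {re} := tighten_sound re.
set t := tighten d s => re.
rewrite (infeasible_sound re) (spread_sound re).
case: ifP => [pt _|_]; first exact: pendant_sound re pt.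
rewrite (terminal_sound re).
by move=> /(branch_sound re) [u [q [su ru]]]; exact: IH ru su.
Qed.

Lemma pendant_K4_of_scaled : pendant_K4_at o.
Proof.
apply: (search_sound (fuel := 70) start_sound).
have := allP search_done (size sorted_nbrs); apply.
have d6 : (size sorted_nbrs < 6)%N.
  by rewrite size_sort -cardE master_deg_lt6.
have d0 : (0 < size sorted_nbrs)%N.
  have [v] := master_has_nbr; rewrite -mem_sorted_nbrs.
  by case: sorted_nbrs.
by move: d0 d6; case: (size _) => [|[|[|[|[|[|]]]]]].
Qed.

End Sound.

(** * Perron vectors and the eigenvalue equation *)

Section Perron.
Variables (R : realType) (G : sgraph).
Implicit Types x : G -> R.

Lemma eigenrow_adj x l :
  (\row_i x (enum_val i) <= eigenspace (adjacency_matrix R G) l)%MS <->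
  forall v, l * x v = \sum_(w | adj v w) x w.
Proof.
have entry j : (\row_i x (enum_val i) *m adjacency_matrix R G) 0 j
    = \sum_(w | adj (enum_val j) w) x w.
  rewrite mxE [RHS]big_mkcond /= [RHS](reindex (@enum_val G predT)) /=; last first.
    by apply: onW_bij; exact: enum_val_bij.
  apply: eq_bigr => i _; rewrite !mxE (adj_sym (enum_val j)).
  by case: adj; rewrite ?mulr1 ?mulr0.
split=> [/eigenspaceP E v|E].
  by have := entry (enum_rank v); rewrite E !mxE enum_rankK.
apply/eigenspaceP/rowP => j; rewrite entry -E !mxE //.
Qed.

Lemma perron_eq x : perron_vector x ->
  (forall v, 0 < x v) /\ exists l, forall v, l * x v = \sum_(w | adj v w) x w.
Proof. by case=> x0 [l _ /eigenrow_adj E]; split=> //; exists l. Qed.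

(** A positive eigenvector belongs to the largest eigenvalue: for any
    eigenvector [z], the eigenvalue equations of [z] and [x] are compared at a
    vertex where $|z_v|/x_v$ is maximal. *)
Lemma perron_of_eq x l (v0 : G) : (forall v, 0 < x v) ->
  (forall v, l * x v = \sum_(w | adj v w) x w) -> perron_vector x.
Proof.
move=> x0 E; split=> //; exists l; last exact/eigenrow_adj.
split.
  apply/eigenvalueP; exists (\row_i x (enum_val i)).
    by apply/eigenspaceP/eigenrow_adj.
  by apply/eqP => /rowP /(_ (enum_rank v0)); rewrite !mxE enum_rankK => /eqP; rewrite gt_eqF.
move=> m /eigenvalueP [y /eigenspaceP yE yn0].
pose z v := y 0 (enum_rank v).
have {}yE : forall v, m * z v = \sum_(w | adj v w) z w.
  apply/eigenrow_adj; rewrite (_ : \row_i _ = y)//.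
  by apply/rowP => i; rewrite mxE /z enum_valK.
have [v zv vmax] : exists2 v, z v != 0 & forall w, `|z w| * x v <= `|z v| * x w.
  have [v _ vmax] := arg_maxP (fun v => `|z v| / x v) (erefl : predT v0).
  have vmax' w : `|z w| * x v <= `|z v| * x w.
    by have /= := vmax w isT; rewrite ler_pdivrMr// mulrAC ler_pdivlMr.
  exists v => //; apply: contra yn0 => /eqP zv0.
  apply/eqP/rowP => i; rewrite mxE -[i]enum_valK -/(z _); apply/eqP.
  have := vmax' (enum_val i); rewrite zv0 normr0 mul0r.
  by rewrite pmulr_lle0 ?x0// normr_le0.
have zv' : 0 < `|z v| by rewrite normr_gt0.
apply: (le_trans (ler_norm m)).
rewrite -(ler_pM2r (mulr_gt0 zv' (x0 v))) mulrA -normrM yE.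
have -> : l * (`|z v| * x v) = \sum_(w | adj v w) `|z v| * x w.
  by rewrite -mulr_sumr -E; ring.
rewrite (le_trans (ler_wpM2r (ltW (x0 v)) (ler_norm_sum _ _ _)))// mulr_suml.
by apply: ler_sum => w _; exact: vmax.
Qed.

End Perron.

Section MainBound.
Variables (R : realType) (G : sgraph).

Lemma effective_order_lt (x : G -> R) : (forall v, 0 < x v) ->
  (0 < #|G|)%N -> effective_order x < 525%:R / 100%:R ->
  4 * (\sum_v x v) ^+ 2 < 21 * \sum_v x v ^+ 2.
Proof.
move=> x0 /card_gt0P[v0 _]; rewrite /effective_order ltr_pdivrMr; last first.
  rewrite (bigD1 v0)//= ltr_pwDl ?exprn_gt0//.
  by apply: sumr_ge0 => v _; exact: sqr_ge0.
lra.
Qed.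

Lemma master_pendant_K4 (x : G -> R) o :
  graph_connected G -> (7 <= #|G|)%N -> ~ isomorphic G D_plus_P3 ->
  perron_vector x -> effective_order x < 525%:R / 100%:R ->
  master_vertex x o -> pendant_K4_at o.
Proof.
move=> conn G7 nex /perron_eq[x0 [l E]] ord mo.
have D0 : 0 < zr R scale by apply: zr_gt0.
pose k := zr R scale / x o.
have k0 : 0 < k by rewrite divr_gt0.
apply: (@pendant_K4_of_scaled R G (fun v => k * x v) l) => //.
- by move=> v; rewrite mulr_gt0.
- by rewrite divfK// gt_eqF.
- by move=> v; rewrite ler_pM2l.
- by move=> v; rewrite -mulr_sumr -E mulrCA.
- have QE : \sum_v (k * x v) ^+ 2 = k ^+ 2 * \sum_v x v ^+ 2.
    by rewrite mulr_sumr; apply: eq_bigr => v _; rewrite exprMn.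
  rewrite QE -mulr_sumr.
  have := effective_order_lt x0 (leq_trans (isT : (0 < 7)%N) G7) ord.
  move: (\sum_v x v) (\sum_v x v ^+ 2) => S Q SQ.
  have : 0 < k ^+ 2 * (21 * Q - 4 * S ^+ 2).
    by apply: mulr_gt0; [exact: exprn_gt0|lra].
  lra.
Qed.

End MainBound.

(** * The exceptional graph *)

Section ExceptionalRoot.
Variable R : realType.
Implicit Types y l : R.

(** $(\lambda-2)(\lambda+1)(\lambda^4-3\lambda^2+1)-2\lambda^2(\lambda^2-2)$ at
    $\lambda=2+y$. After the shift only the two lowest coefficients are negative,
    so the positive root is unique. *)
Definition exc_poly y : R :=
  y ^+ 6 + 11 * y ^+ 5 + 43 * y ^+ 4 + 67 * y ^+ 3 + 21 * y ^+ 2 - 33 * y - 16.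

Definition exc_lo : R := 658249925%:R / 10%:R ^+ 9.
Definition exc_hi : R := 658249926%:R / 10%:R ^+ 9.

(** The difference quotient has only one negative term, $-33$, which is
    outweighed by $67z^2+21z$ when $z\ge 0.6$. So the sign of [exc_poly] at such
    a [z] tells on which side of it the root lies. *)
Lemma exc_poly_mono y z : 0 < y -> 6 / 10 <= z ->
  exists2 q : R, 0 < q & exc_poly y - exc_poly z = (y - z) * q.
Proof.
move=> y0 z0.
exists (y ^+ 5 + y ^+ 4 * z + y ^+ 3 * z ^+ 2 + y ^+ 2 * z ^+ 3 + y * z ^+ 4 + z ^+ 5
  + 11 * (y ^+ 4 + y ^+ 3 * z + y ^+ 2 * z ^+ 2 + y * z ^+ 3 + z ^+ 4)
  + 43 * (y ^+ 3 + y ^+ 2 * z + y * z ^+ 2 + z ^+ 3)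
  + 67 * (y ^+ 2 + y * z) + 21 * y + (67 * z ^+ 2 + 21 * z - 33)); last first.
  by rewrite /exc_poly; ring.
have z1 : 0 < z by lra.
have z2 : 0 < 67 * z ^+ 2 + 21 * z - 33.
  have : 0 <= (z - 6 / 10) * (z + 6 / 10) by apply: mulr_ge0; lra.
  lra.
rewrite addr_gt0//.
by rewrite !(addr_gt0, mulr_gt0, exprn_gt0)// ?ltr0n.
Qed.

Lemma exc_poly_lo : exc_poly exc_lo < 0.
Proof. rewrite /exc_poly /exc_lo; lra. Qed.

Lemma exc_poly_hi : 0 < exc_poly exc_hi.
Proof. rewrite /exc_poly /exc_hi; lra. Qed.

End ExceptionalRoot.

Section ExceptionalOrder.
Variable R : realType.
Implicit Types l : R.

(** Sum and sum of squares of the solution in [exceptional_system] with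
    [k = 1]. *)
Definition exc_sum l : R := 2 * l ^+ 5 + 4 * l ^+ 4 - 4 * l ^+ 3 - 8 * l ^+ 2 + 2 * l + 2.
Definition exc_sqr l : R :=
  2 * l ^+ 10 - 4 * l ^+ 8 - 14 * l ^+ 6 + 44 * l ^+ 4 - 14 * l ^+ 2 + 4.

Lemma pow_step l k (p q p' q' r s : R) : 0 <= p -> 0 <= r -> r <= l -> l <= s ->
  p <= l ^+ k <= q -> p' <= p * r -> q * s <= q' -> p' <= l ^+ k.+1 <= q'.
Proof.
move=> p0 r0 rl ls /andP[pl lq] pr qs; rewrite exprSr.
have l0 := le_trans r0 rl.
rewrite (le_trans pr) ?ler_pM// (le_trans _ qs)// ler_pM// exprn_ge0//.
Qed.

Lemma exc_order_bounds l :
  2658249925%:R / 10%:R ^+ 9 <= l -> l <= 2658249926%:R / 10%:R ^+ 9 ->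
  [/\ 0 < exc_sqr l,
      51805445%:R / 10%:R ^+ 7 * exc_sqr l <= exc_sum l ^+ 2 &
      exc_sum l ^+ 2 <= 51805455%:R / 10%:R ^+ 7 * exc_sqr l].
Proof.
move=> rl ls.
have r0 : 0 <= 2658249925%:R / 10%:R ^+ 9 :> R by lra.
have step k p q p' q' : 0 <= p -> p <= l ^+ k <= q ->
    p' <= p * (2658249925%:R / 10%:R ^+ 9) ->
    q * (2658249926%:R / 10%:R ^+ 9) <= q' -> p' <= l ^+ k.+1 <= q'.
  by move=> p0 h; exact: (pow_step p0 r0 rl ls h).
(* Enclosures of the powers of [l] make both inequalities linear. *)
have e1 : 2658249925%:R / 10%:R ^+ 9 <= l ^+ 1 <= 2658249926%:R / 10%:R ^+ 9.
  by rewrite expr1; apply/andP; split; [exact: rl|exact: ls].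
have e2 : 70662926%:R / 10%:R ^+ 7 <= l ^+ 2 <= 70662927%:R / 10%:R ^+ 7.
  by apply: (step _ _ _ _ _ _ e1); clear; lra.
have e3 : 187839717%:R / 10%:R ^+ 7 <= l ^+ 3 <= 187839721%:R / 10%:R ^+ 7.
  by apply: (step _ _ _ _ _ _ e2); clear; lra.
have e4 : 499324913%:R / 10%:R ^+ 7 <= l ^+ 4 <= 499324925%:R / 10%:R ^+ 7.
  by apply: (step _ _ _ _ _ _ e3); clear; lra.
have e5 : 1327330412%:R / 10%:R ^+ 7 <= l ^+ 5 <= 1327330445%:R / 10%:R ^+ 7.
  by apply: (step _ _ _ _ _ _ e4); clear; lra.
have e6 : 3528375968%:R / 10%:R ^+ 7 <= l ^+ 6 <= 3528376058%:R / 10%:R ^+ 7.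
  by apply: (step _ _ _ _ _ _ e5); clear; lra.
have e7 : 9379305152%:R / 10%:R ^+ 7 <= l ^+ 7 <= 9379305396%:R / 10%:R ^+ 7.
  by apply: (step _ _ _ _ _ _ e6); clear; lra.
have e8 : 24932537216%:R / 10%:R ^+ 7 <= l ^+ 8 <= 24932537875%:R / 10%:R ^+ 7.
  by apply: (step _ _ _ _ _ _ e7); clear; lra.
have e9 : 66276915184%:R / 10%:R ^+ 7 <= l ^+ 9 <= 66276916962%:R / 10%:R ^+ 7.
  by apply: (step _ _ _ _ _ _ e8); clear; lra.
have e10 : 176180604817%:R / 10%:R ^+ 7 <= l ^+ 10 <= 176180609610%:R / 10%:R ^+ 7.
  by apply: (step _ _ _ _ _ _ e9); clear; lra.
rewrite /exc_sum /exc_sqr; split; lra.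
Qed.

End ExceptionalOrder.

Section Exception.
Variable R : realType.
Implicit Types x : D_plus_P3 -> R.

Local Notation vb := (inl (@Ordinal 4 2 isT) : D_plus_P3).
Local Notation vb' := (inl (@Ordinal 4 3 isT) : D_plus_P3).
Local Notation vs := (inl (@Ordinal 4 0 isT) : D_plus_P3).
Local Notation vc := (inl (@Ordinal 4 1 isT) : D_plus_P3).
Local Notation vu := (inr (@Ordinal 3 0 isT) : D_plus_P3).
Local Notation vw := (inr (@Ordinal 3 1 isT) : D_plus_P3).
Local Notation vt := (inr (@Ordinal 3 2 isT) : D_plus_P3).

Lemma sum_exceptional (P : pred D_plus_P3) (F : D_plus_P3 -> R) :
  \sum_(v | P v) F v = \sum_(v <- exceptional_list | P v) F v.
Proof.
rewrite -[RHS]big_filter [RHS]big_uniq ?filter_uniq//.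
by apply: eq_bigl => v; rewrite mem_filter mem_exceptional_list andbT.
Qed.

Lemma eig_exceptional x l : (forall v, l * x v = \sum_(w | adj v w) x w) <->
  [/\ l * x vb = x vb' + x vs + x vc, l * x vb' = x vb + x vs + x vc,
      l * x vs = x vb + x vb' + x vu & l * x vc = x vb + x vb'] /\
  [/\ l * x vu = x vs + x vw, l * x vw = x vu + x vt & l * x vt = x vw].
Proof.
have big v : \sum_(w | adj v w) x w =
    \sum_(w <- exceptional_list | adj v w) x w by exact: sum_exceptional.
split=> [E|[[Eb Eb' Es Ec] [Eu Ew Et]] v].
  by split; split; rewrite E big !big_cons big_nil /= ?addr0 ?addrA.
have : v \in exceptional_list by exact: mem_exceptional_list.
rewrite big !inE => /or4P[/eqP->|/eqP->|/eqP->|/or4P[]/eqP->];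
  by rewrite !big_cons big_nil /= ?addr0 ?addrA.
Qed.

Definition exc_twin (l : R) : R := l ^+ 4 - 3 * l ^+ 2 + 1.

(** The twins [b] and [b'] have equal weights, since $(\lambda+1)(b-b')=0$. Going
    up the path from its end [t] each equation gives the next weight; the
    equation at [b] is left over and becomes the sextic. Its right side
    $2\lambda^2(\lambda^2-2)$ is proportional to the weight [s], hence positive, and
    this forces $\lambda>2$. *)
Lemma exceptional_system (b b' s c u w t l : R) :
  0 < b -> 0 < s -> 0 < w -> 0 < t ->
  [/\ l * b = b' + s + c, l * b' = b + s + c,
      l * s = b + b' + u & l * c = b + b'] ->
  [/\ l * u = s + w, l * w = u + t & l * t = w] ->
  exists2 k : R, 0 < k & 2 < l /\ exc_poly (l - 2) = 0 /\
  [/\ b = k * (l * exc_twin l), b' = k * (l * exc_twin l),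
      s = k * (2 * l ^+ 2 * (l ^+ 2 - 2)) & c = k * (2 * exc_twin l)] /\
  [/\ u = k * (2 * l * (l ^+ 2 - 1)), w = k * (2 * l ^+ 2) & t = k * (2 * l)].
Proof.
move=> b0 s0 w0 t0 [Eb Eb' Es Ec] [Eu Ew Et].
have l0 : 0 < l by rewrite -(pmulr_lgt0 _ t0) Et.
have bb : b' = b.
  have : (l + 1) * (b' - b) = 0 by lra.
  by move/eqP; rewrite mulf_eq0 subr_eq0 => /orP[|/eqP//]; rewrite gt_eqF// addr_gt0.
pose k := t / (2 * l).
have l2 : 2 * l != 0 by rewrite mulf_neq0 ?gt_eqF.
have k0 : 0 < k by rewrite divr_gt0// mulr_gt0.
have tk : t = k * (2 * l) by rewrite /k divfK.
have wk : w = k * (2 * l ^+ 2) by rewrite -Et tk; ring.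
have uk : u = k * (2 * l * (l ^+ 2 - 1)).
  by rewrite -[LHS](addrK t) -Ew wk tk; ring.
have sk : s = k * (2 * l ^+ 2 * (l ^+ 2 - 2)).
  by rewrite -[LHS](addrK w) -Eu wk uk; ring.
have bk : b = k * (l * exc_twin l).
  have : 2 * b = l * s - u by rewrite Es bb; ring.
  rewrite sk uk /exc_twin; lra.
have ck : c = k * (2 * exc_twin l).
  apply: (mulfI (lt0r_neq0 l0)); rewrite Ec bb bk; ring.
have E : (l - 2) * (l + 1) * exc_twin l = 2 * l ^+ 2 * (l ^+ 2 - 2).
  apply: (mulfI (lt0r_neq0 k0)); rewrite -sk.
  have -> : s = l * b - b - c by rewrite Eb bb; ring.
  by rewrite bk ck /exc_twin; ring.
have B0 : 0 < exc_twin l.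
  by move: b0; rewrite bk pmulr_rgt0// pmulr_rgt0.
have s0' : 0 < 2 * l ^+ 2 * (l ^+ 2 - 2) by move: s0; rewrite sk pmulr_rgt0.
exists k => //; split.
  have l1 : 0 < l + 1 by rewrite addr_gt0.
  by move: s0'; rewrite -E pmulr_lgt0// pmulr_lgt0// subr_gt0.
split; first by move: E; rewrite /exc_twin /exc_poly; lra.
by rewrite bb.
Qed.

Lemma exc_root_bounds (l : R) : 2 < l -> exc_poly (l - 2) = 0 ->
  2658249925%:R / 10%:R ^+ 9 <= l /\ l <= 2658249926%:R / 10%:R ^+ 9.
Proof.
move=> l2 l_root; have y0 : 0 < l - 2 by lra.
have [|q q0] := @exc_poly_mono R _ (exc_lo R) y0; first by rewrite /exc_lo; lra.
rewrite l_root sub0r => qE.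
have [|r r0] := @exc_poly_mono R _ (exc_hi R) y0; first by rewrite /exc_hi; lra.
rewrite l_root sub0r => rE.
have := exc_poly_lo R; rewrite -oppr_gt0 qE pmulr_lgt0// subr_gt0 /exc_lo => lo_l.
have := exc_poly_hi R; rewrite -oppr_lt0 rE pmulr_llt0// subr_lt0 /exc_hi => l_hi.
clear -lo_l l_hi; split; lra.
Qed.

Lemma exc_poly_ivt (a b : R) : a <= b -> exc_poly a <= 0 -> 0 <= exc_poly b ->
  exists2 y : R, a <= y & exc_poly y = 0.
Proof.
move=> ab a0 b0.
pose p : {poly R} := 'X^6 + 11 *: 'X^5 + 43 *: 'X^4 + 67 *: 'X^3 + 21 *: 'X^2
  - 33 *: 'X - 16%:P.
have pE y : p.[y] = exc_poly y by rewrite /p /exc_poly !hornerE.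
have [|y /andP[ay _] /rootP py] := @poly_ivt _ p _ _ ab; first by rewrite !pE a0.
by exists y; rewrite // -pE.
Qed.

Lemma exc_root_exists : exists2 l : R, 2 < l & exc_poly (l - 2) = 0.
Proof.
have lohi : exc_lo R <= exc_hi R by rewrite /exc_lo /exc_hi; lra.
have [y ly y0] := exc_poly_ivt lohi (ltW (exc_poly_lo R)) (ltW (exc_poly_hi R)).
exists (2 + y); last by rewrite addrC addKr.
by clear -ly; rewrite /exc_lo in ly; lra.
Qed.

Lemma exceptional_connected : graph_connected D_plus_P3.
Proof.
have csym : connect_sym (@adj D_plus_P3) by apply: sym_connect_sym; exact: adj_sym.
have toward v : connect (@adj D_plus_P3) vs v.
  have e1 : connect (@adj D_plus_P3) vs vb by exact: connect1.
  have e2 : connect (@adj D_plus_P3) vs vb' by exact: connect1.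
  have e3 : connect (@adj D_plus_P3) vs vc by apply: connect_trans e1 (connect1 _).
  have e4 : connect (@adj D_plus_P3) vs vu by exact: connect1.
  have e5 : connect (@adj D_plus_P3) vs vw by apply: connect_trans e4 (connect1 _).
  have e6 : connect (@adj D_plus_P3) vs vt by apply: connect_trans e5 (connect1 _).
  have : v \in exceptional_list by exact: mem_exceptional_list.
  by rewrite !inE => /or4P[/eqP->|/eqP->|/eqP->|/or4P[]/eqP->].
by move=> v w; apply: (@connect_trans _ _ vs); rewrite // csym.
Qed.

Lemma card_exceptional : #|D_plus_P3| = 7%N.
Proof. by rewrite card_sum !card_ord. Qed.

Lemma exceptional_perron : exists x, @perron_vector R D_plus_P3 x.
Proof.
have [l l2 l_root] := exc_root_exists.
pose x (v : D_plus_P3) : R :=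
  if v \in [:: vb; vb'] then l * exc_twin l else
  if v == vs then 2 * l ^+ 2 * (l ^+ 2 - 2) else
  if v == vc then 2 * exc_twin l else
  if v == vu then 2 * l * (l ^+ 2 - 1) else
  if v == vw then 2 * l ^+ 2 else 2 * l.
have l0 : 0 < l by lra.
have ll : 4 < l ^+ 2.
  have : 0 < (l - 2) * (l + 2) by apply: mulr_gt0; lra.
  lra.
have B0 : 0 < exc_twin l.
  have : 0 < (l ^+ 2 - 4) * (l ^+ 2 + 1) by apply: mulr_gt0; lra.
  rewrite /exc_twin; lra.
exists x; apply: (@perron_of_eq _ _ _ l vs).
  move=> v; rewrite /x; do !case: ifP => _; rewrite !mulr_gt0 ?exprn_gt0 ?ltr0n//; lra.
apply/eig_exceptional; rewrite /x /=.
rewrite /exc_twin.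
move: l_root; rewrite /exc_poly => l_root.
by split; split; rewrite /=; lra.
Qed.

Lemma exceptional_order x : perron_vector x ->
  51805445%:R / 10%:R ^+ 7 <= effective_order x <= 51805455%:R / 10%:R ^+ 7.
Proof.
move=> /perron_eq[x0 [l /eig_exceptional [E1 E2]]].
have [k k0 [l2 [l_root [[xb xb' xs xc] [xu xw xt]]]]] :=
  exceptional_system (x0 _) (x0 _) (x0 _) (x0 _) E1 E2.
have [lo_l l_hi] := exc_root_bounds l2 l_root.
have [Q0 Slo Shi] := exc_order_bounds lo_l l_hi.
have SE : \sum_v x v = k * exc_sum l.
  rewrite sum_exceptional !big_cons big_nil /= xb xb' xs xc xu xw xt.
  rewrite /exc_sum /exc_twin; ring.
have QE : \sum_v x v ^+ 2 = k ^+ 2 * exc_sqr l.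
  rewrite sum_exceptional !big_cons big_nil /= xb xb' xs xc xu xw xt.
  rewrite /exc_sqr /exc_twin; ring.
have -> : effective_order x = exc_sum l ^+ 2 / exc_sqr l.
  have k2 : k ^+ 2 != 0 by rewrite expf_neq0 ?gt_eqF.
  by rewrite /effective_order SE QE exprMn -mulf_div divff ?mul1r.
apply/andP; split.
  by rewrite (ler_pdivlMr _ _ Q0); exact: Slo.
by rewrite (ler_pdivrMr _ _ Q0); exact: Shi.
Qed.

Lemma exceptional_deg (v : D_plus_P3) : (#|closed_nbhd v| <= 4)%N.
Proof.
have -> : #|closed_nbhd v| = count (mem (closed_nbhd v)) exceptional_list.
  rewrite -size_filter cardE; apply: perm_size; apply: uniq_perm.
  - exact: enum_uniq.
  - exact: filter_uniq.
  - by move=> w; rewrite mem_enum mem_filter mem_exceptional_list andbT.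
have : v \in exceptional_list by exact: mem_exceptional_list.
by rewrite !inE => /or4P[/eqP->|/eqP->|/eqP->|/or4P[]/eqP->]; rewrite /= !inE.
Qed.

Lemma exceptional_not_pendant (o : D_plus_P3) : ~ pendant_K4_at o.
Proof.
case=> C [u [_ _ [f [f_bij _]]]]; have := exceptional_deg o.
have := bij_eq_card f_bij; rewrite card_sum !card_ord.
by rewrite card_sig => ->.
Qed.

End Exception.

Theorem theorem1p7 (R : realType) :
  (forall (G : sgraph) (x : G -> R),
     graph_connected G -> (8 <= #|G|)%N -> perron_vector x ->
     effective_order x < 525%:R / 100%:R ->
     forall o : G, master_vertex x o -> pendant_K4_at o) /\
  (forall (G : sgraph) (x : G -> R),
     graph_connected G -> #|G| = 7%N -> perron_vector x ->
     effective_order x < 525%:R / 100%:R ->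
     ~ isomorphic G D_plus_P3 ->
     forall o : G, master_vertex x o -> pendant_K4_at o) /\
  [/\ graph_connected D_plus_P3,
      #|D_plus_P3| = 7%N,
      exists x : D_plus_P3 -> R, perron_vector x
    & forall x : D_plus_P3 -> R, perron_vector x ->
      [/\ effective_order x < 525%:R / 100%:R,
          `|effective_order x - 5180545%:R / 10%:R ^+ 6| <= 5%:R / 10%:R ^+ 7
        & forall o : D_plus_P3, master_vertex x o -> ~ pendant_K4_at o]].
Proof.
split; [|split].
- move=> G x conn G8 px ord o; apply: master_pendant_K4 => //; first exact: ltnW.
  case=> f [f_bij _]; move: G8.
  by rewrite (bij_eq_card f_bij) card_exceptional.
- move=> G x conn G7 px ord nex o.
  by apply: master_pendant_K4 => //; rewrite G7.
split.
- exact: exceptional_connected.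
- exact: card_exceptional.
- exact: exceptional_perron.
move=> x px; have /andP[lo hi] := exceptional_order px.
split; last by move=> o _; exact: exceptional_not_pendant.
  by clear -hi; lra.
rewrite ler_norml; apply/andP; split; clear -lo hi; lra.
Qed.
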